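(* Let $r,\sigma$ be nonzero real constants and consider the Bachelier PDE $$ rS\,\frac{\partial C}{\partial S}+\frac12\sigma^2\frac{\partial^2 C}{\partial S^2}+\frac{\partial C}{\partial t}-rC=0 $$ for an unknown function $C=C(t,S)$. A smooth vector field $$\xi=\mathcal T(t,S,C)\frac{\partial}{\partial t}+\mathcal S(t,S,C)\frac{\partial}{\partial S}+\mathcal C(t,S,C)\frac{\partial}{\partial C}$$ is an infinitesimal Lie point symmetry of this PDE if and only if there are real constants $c_1,\dots,c_6$ and a solution $\psi(t,S)$ of the same PDE such that $$\mathcal T=c_1-\frac{e^{-2rt}\left(c_4-c_5e^{4rt}\right)}{2r},\qquad \mathcal S=\frac12e^{-2rt}\left(2c_2e^{3rt}+2c_3e^{rt}+c_4S+c_5Se^{4rt}\right),$$ $$\mathcal C=\frac{e^{-2rt}}{2\sigma^2}\Big(\big(\sigma^2(-2c_4+c_5e^{4rt}+2c_6e^{2rt})-2rS(2c_3e^{rt}+c_4S)\big)C+2\sigma^2e^{2rt}\psi(t,S)\Big).$$ The symmetries corresponding to the six constants (i.e. with $\psi=0$) form a six-dimensional Lie algebra with basis $$\xi_1=\frac{\partial}{\partial t},\qquad \xi_2=e^{rt}\frac{\partial}{\partial S},\qquad \xi_3=e^{-rt}\frac{\partial}{\partial S}-\frac{2e^{-rt}rSC}{\sigma^2}\frac{\partial}{\partial C},$$ $$\xi_4=-\frac{e^{-2rt}}{2r}\frac{\partial}{\partial t}+\frac12e^{-2rt}S\frac{\partial}{\partial S}-\frac{e^{-2rt}(\sigma^2+rS^2)C}{\sigma^2}\frac{\partial}{\partial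 C},$$ $$\xi_5=\frac{e^{2rt}}{2r}\frac{\partial}{\partial t}+\frac12e^{2rt}S\frac{\partial}{\partial S}+\frac12e^{2rt}C\frac{\partial}{\partial C},\qquad \xi_6=C\frac{\partial}{\partial C}.$$ The corresponding six (local) one-parameter Lie groups of symmetry transformations generated by $\xi_1,\dots,\xi_6$ are, up to reparametrization and with real parameters $\varepsilon_1,\dots,\varepsilon_6$, respectively $$G_1:(t,S,C)\mapsto(t+\varepsilon_1,\,S,\,C),\qquad G_2:(t,S,C)\mapsto(t,\,S+\varepsilon_2e^{rt},\,C),$$ $$G_3:(t,S,C)\mapsto\left(t,\,S+\varepsilon_3e^{-rt},\,e^{-\frac{\varepsilon_3re^{-rt}(\varepsilon_3e^{-rt}+2S)}{\sigma^2}}C\right),$$ $$G_4:(t,S,C)\mapsto\left(\frac{\ln(e^{2rt}+\varepsilon_4)}{2r},\,\frac{e^{rt}S}{\sqrt{e^{2rt}+\varepsilon_4}},\,e^{-\frac{r\left(2\sigma^2t(e^{2rt}+\varepsilon_4)-\varepsilon_4S^2\right)}{\sigma^2(e^{2rt}+\varepsilon_4)}}(e^{2rt}+\varepsilon_4)\,C\right),$$ $$G_5:(t,S,C)\mapsto\left(-\frac{\ln(e^{-2rt}+\varepsilon_5)}{2r},\,\frac{e^{-rt}S}{\sqrt{e^{-2rt}+\varepsilon_5}},\,\frac{e^{-rt}C}{\sqrt{e^{-2rt}+\varepsilon_5}}\right),\qquad G_6:(t,S,C)\mapsto(t,\,S,\,e^{\varepsilon_6}C),$$ where $G_4$ is defined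 where $e^{2rt}+\varepsilon_4>0$ and $G_5$ where $e^{-2rt}+\varepsilon_5>0$.
   Context: The variables $(t,S,C)$ range over $\mathbb R^3$. Put $F=rSC_S+\frac12\sigma^2C_{SS}+C_t-rC$, regarded as a function of the jet coordinates $(t,S,C,C_t,C_S,C_{tt},C_{tS},C_{SS})$. The vector field $\xi$ is an infinitesimal Lie point symmetry of the PDE if its second prolongation $\mathrm{pr}^2\xi$ (the standard prolongation to the second jet space) satisfies $\mathrm{pr}^2\xi\,F=0$ at all points of the jet space where $F=0$. A one-parameter Lie group of symmetry transformations generated by $\xi$ is the flow $(t,S,C)\mapsto(t^*,S^*,C^* )$ obtained by solving $\frac{dt^*}{d\lambda}=\mathcal T(t^*,S^*,C^* )$, $\frac{dS^*}{d\lambda}=\mathcal S(t^*,S^*,C^* )$, $\frac{dC^*}{d\lambda}=\mathcal C(t^*,S^*,C^* )$ with $(t^*,S^*,C^* )|_{\lambda=0}=(t,S,C)$. ''Up to reparametrization'' means that the group parameter $\varepsilon_i$ is a reparametrization of the flow parameter $\lambda$. *)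

(* Defs.v *)
From Stdlib Require Export Reals List.
From Coquelicot Require Export Coquelicot.
Export ListNotations.
Open Scope R_scope.

(** ** Smooth functions on R^2 and R^3 *)

(* C^0 is joint continuity; C^(k+1) means that all first partial derivatives
   exist everywhere and are C^k (so that the function itself is C^0 too). *)
Fixpoint class2 (k : nat) (f : R -> R -> R) : Prop :=
  match k with
  | O => forall t s, continuous (fun p : R * R => f (fst p) (snd p)) (t, s)
  | S k' =>
      (forall t s, ex_derive (fun x => f x s) t) /\
      (forall t s, ex_derive (fun x => f t x) s) /\
      class2 k' (fun t s => Derive (fun x => f x s) t) /\
      class2 k' (fun t s => Derive (fun x => f t x) s)
  end.

Definition smooth2 (f : R -> R -> R) : Prop := forall k, class2 k f.

Fixpoint class3 (k : nat) (f : R -> R -> R -> R) : Prop :=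
  match k with
  | O => forall t s c,
      continuous (fun p : R * R * R => f (fst (fst p)) (snd (fst p)) (snd p))
                 (t, s, c)
  | S k' =>
      (forall t s c, ex_derive (fun x => f x s c) t) /\
      (forall t s c, ex_derive (fun x => f t x c) s) /\
      (forall t s c, ex_derive (fun x => f t s x) c) /\
      class3 k' (fun t s c => Derive (fun x => f x s c) t) /\
      class3 k' (fun t s c => Derive (fun x => f t x c) s) /\
      class3 k' (fun t s c => Derive (fun x => f t s x) c)
  end.

Definition smooth3 (f : R -> R -> R -> R) : Prop := forall k, class3 k f.

(** ** Vector fields on R^3 *)

(* The vector field  vt d/dt + vs d/dS + vc d/dC  on (t,S,C)-space. *)
Record vfield := VField {
  vt : R -> R -> R -> R;
  vs : R -> R -> R -> R;
  vc : R -> R -> R -> R }.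

Definition smooth_field (xi : vfield) : Prop :=
  smooth3 (vt xi) /\ smooth3 (vs xi) /\ smooth3 (vc xi).

Definition veq (xi eta : vfield) : Prop :=
  forall t s c, vt xi t s c = vt eta t s c /\
                vs xi t s c = vs eta t s c /\
                vc xi t s c = vc eta t s c.

Definition vzero : vfield :=
  VField (fun _ _ _ => 0) (fun _ _ _ => 0) (fun _ _ _ => 0).

Definition vadd (xi eta : vfield) : vfield :=
  VField (fun t s c => vt xi t s c + vt eta t s c)
         (fun t s c => vs xi t s c + vs eta t s c)
         (fun t s c => vc xi t s c + vc eta t s c).

Definition vscale (a : R) (xi : vfield) : vfield :=
  VField (fun t s c => a * vt xi t s c)
         (fun t s c => a * vs xi t s c)
         (fun t s c => a * vc xi t s c).

(* The derivation of functions defined by a vector field. *)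
Definition vact (xi : vfield) (f : R -> R -> R -> R) : R -> R -> R -> R :=
  fun t s c => vt xi t s c * Derive (fun x => f x s c) t
             + vs xi t s c * Derive (fun x => f t x c) s
             + vc xi t s c * Derive (fun x => f t s x) c.

Definition bracket (xi eta : vfield) : vfield :=
  VField (fun t s c => vact xi (vt eta) t s c - vact eta (vt xi) t s c)
         (fun t s c => vact xi (vs eta) t s c - vact eta (vs xi) t s c)
         (fun t s c => vact xi (vc eta) t s c - vact eta (vc xi) t s c).

Definition lie_algebra (V : vfield -> Prop) : Prop :=
  V vzero /\
  (forall xi eta, V xi -> V eta -> V (vadd xi eta)) /\
  (forall a xi, V xi -> V (vscale a xi)) /\
  (forall xi eta, V xi -> V eta -> V (bracket xi eta)).

Fixpoint lincomb (a : list R) (e : list vfield) : vfield :=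
  match a, e with
  | x :: a', xi :: e' => vadd (vscale x xi) (lincomb a' e')
  | _, _ => vzero
  end.

(* V is meant to be a linear subspace; its dimension is then [length e]. *)
Definition is_basis (V : vfield -> Prop) (e : list vfield) : Prop :=
  (forall xi, In xi e -> V xi) /\
  (forall xi, V xi ->
     exists a, length a = length e /\ veq xi (lincomb a e)) /\
  (forall a, length a = length e -> veq (lincomb a e) vzero ->
     forall x, In x a -> x = 0).

(** ** The second jet space and prolongations *)

(* Coordinates (t,S,C,C_t,C_S,C_tt,C_tS,C_SS) of the second jet space. *)
Inductive coord := Jt | JS | JC | JCt | JCS | JCtt | JCtS | JCSS.

Definition jet := coord -> R.

Definition coord_eq_dec (i j : coord) : {i = j} + {i <> j}.
Proof. decide equality. Defined.

Definition upd (p : jet) (i : coord) (x : R) : jet :=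
  fun j => if coord_eq_dec i j then x else p j.

(* Partial derivative with respect to the i-th jet coordinate. *)
Definition pd (i : coord) (f : jet -> R) (p : jet) : R :=
  Derive (fun x => f (upd p i x)) (p i).

(* Total derivatives D_t and D_S of functions of (t,S,C,C_t,C_S): the terms in
   third-order derivatives of C are left out, so these are the total
   derivatives only for functions that do not depend on C_tt, C_tS, C_SS. *)
Definition Dt (f : jet -> R) (p : jet) : R :=
  pd Jt f p + p JCt * pd JC f p + p JCtt * pd JCt f p + p JCtS * pd JCS f p.

Definition DS (f : jet -> R) (p : jet) : R :=
  pd JS f p + p JCS * pd JC f p + p JCtS * pd JCt f p + p JCSS * pd JCS f p.

Definition lift (f : R -> R -> R -> R) : jet -> R :=
  fun p => f (p Jt) (p JS) (p JC).

Definition phi_t (xi : vfield) (p : jet) : R :=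
  Dt (lift (vc xi)) p - p JCt * Dt (lift (vt xi)) p
                      - p JCS * Dt (lift (vs xi)) p.

Definition phi_S (xi : vfield) (p : jet) : R :=
  DS (lift (vc xi)) p - p JCt * DS (lift (vt xi)) p
                      - p JCS * DS (lift (vs xi)) p.

Definition phi_tt (xi : vfield) (p : jet) : R :=
  Dt (phi_t xi) p - p JCtt * Dt (lift (vt xi)) p
                  - p JCtS * Dt (lift (vs xi)) p.

Definition phi_tS (xi : vfield) (p : jet) : R :=
  DS (phi_t xi) p - p JCtt * DS (lift (vt xi)) p
                  - p JCtS * DS (lift (vs xi)) p.

Definition phi_SS (xi : vfield) (p : jet) : R :=
  DS (phi_S xi) p - p JCtS * DS (lift (vt xi)) p
                  - p JCSS * DS (lift (vs xi)) p.

(* Components of pr^2 xi in the jet coordinates. *)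
Definition pr2 (xi : vfield) (i : coord) : jet -> R :=
  match i with
  | Jt => lift (vt xi)
  | JS => lift (vs xi)
  | JC => lift (vc xi)
  | JCt => phi_t xi
  | JCS => phi_S xi
  | JCtt => phi_tt xi
  | JCtS => phi_tS xi
  | JCSS => phi_SS xi
  end.

Definition pr2_apply (xi : vfield) (F : jet -> R) (p : jet) : R :=
    pr2 xi Jt p * pd Jt F p + pr2 xi JS p * pd JS F p
  + pr2 xi JC p * pd JC F p
  + pr2 xi JCt p * pd JCt F p + pr2 xi JCS p * pd JCS F p
  + pr2 xi JCtt p * pd JCtt F p + pr2 xi JCtS p * pd JCtS F p
  + pr2 xi JCSS p * pd JCSS F p.

Definition lie_point_symmetry (F : jet -> R) (xi : vfield) : Prop :=
  forall p : jet, F p = 0 -> pr2_apply xi F p = 0.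

Definition jet_of (psi : R -> R -> R) (t s : R) : jet := fun i =>
  match i with
  | Jt => t
  | JS => s
  | JC => psi t s
  | JCt => Derive (fun x => psi x s) t
  | JCS => Derive (fun y => psi t y) s
  | JCtt => Derive (fun x => Derive (fun x' => psi x' s) x) t
  | JCtS => Derive (fun y => Derive (fun x => psi x y) t) s
  | JCSS => Derive (fun y => Derive (fun y' => psi t y') y) s
  end.

Definition solution (F : jet -> R) (psi : R -> R -> R) : Prop :=
  smooth2 psi /\ forall t s, F (jet_of psi t s) = 0.

(** ** Flows of vector fields *)

Definition point := (R * R * R)%type.
Definition pt (q : point) : R := fst (fst q).
Definition ps (q : point) : R := snd (fst q).
Definition pc (q : point) : R := snd q.

Definition integral_curve (xi : vfield) (J : R -> Prop) (g : R -> point)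
    : Prop :=
  forall l, J l ->
    is_derive (fun x => pt (g x)) l (vt xi (pt (g l)) (ps (g l)) (pc (g l))) /\
    is_derive (fun x => ps (g x)) l (vs xi (pt (g l)) (ps (g l)) (pc (g l))) /\
    is_derive (fun x => pc (g x)) l (vc xi (pt (g l)) (ps (g l)) (pc (g l))).

Definition open_interval_at_0 (J : R -> Prop) : Prop :=
  open J /\ J 0 /\ (forall a b x, J a -> J b -> a <= x <= b -> J x).

(* Phi is the maximal (local) flow of xi: for every starting point q, the curve
   [fun l => Phi l q] on the interval [D q] is the integral curve through q,
   and it extends every other one. *)
Definition is_flow (xi : vfield) (D : point -> R -> Prop)
    (Phi : R -> point -> point) : Prop :=
  forall q : point,
    open_interval_at_0 (D q) /\
    Phi 0 q = q /\
    integral_curve xi (D q) (fun l => Phi l q) /\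
    (forall J g, open_interval_at_0 J -> integral_curve xi J g -> g 0 = q ->
       forall l, J l -> D q l /\ g l = Phi l q).

(* Smooth change of the group parameter: a diffeomorphism of R fixing 0. *)
Definition reparametrization (phi : R -> R) : Prop :=
  phi 0 = 0 /\
  (forall n x, ex_derive_n phi n x) /\
  (forall x, Derive phi x <> 0) /\
  (forall y, exists x, phi x = y).

(* [G eps] is the local transformation with parameter eps, defined at those
   points q where [E eps q] holds. *)
Definition generates (xi : vfield) (E : R -> point -> Prop)
    (G : R -> point -> point) : Prop :=
  exists phi, reparametrization phi /\
    is_flow xi (fun q l => E (phi l) q) (fun l q => G (phi l) q).

Definition everywhere (eps : R) (q : point) : Prop := True.

(** ** The Bachelier equation *)

Definition bachelier (r sigma : R) : jet -> R := fun p =>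
  r * p JS * p JCS + 1 / 2 * sigma ^ 2 * p JCSS + p JCt - r * p JC.

Definition bachelier_field (r sigma c1 c2 c3 c4 c5 c6 : R)
    (psi : R -> R -> R) : vfield :=
  VField
    (fun t s c =>
       c1 - exp (-2 * r * t) * (c4 - c5 * exp (4 * r * t)) / (2 * r))
    (fun t s c =>
       1 / 2 * exp (-2 * r * t) *
       (2 * c2 * exp (3 * r * t) + 2 * c3 * exp (r * t)
        + c4 * s + c5 * s * exp (4 * r * t)))
    (fun t s c =>
       exp (-2 * r * t) / (2 * sigma ^ 2) *
       ((sigma ^ 2 * (-2 * c4 + c5 * exp (4 * r * t)
                      + 2 * c6 * exp (2 * r * t))
         - 2 * r * s * (2 * c3 * exp (r * t) + c4 * s)) * c
        + 2 * sigma ^ 2 * exp (2 * r * t) * psi t s)).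

(* The symmetries with psi = 0. *)
Definition bachelier_algebra (r sigma : R) (xi : vfield) : Prop :=
  smooth_field xi /\ lie_point_symmetry (bachelier r sigma) xi /\
  exists c1 c2 c3 c4 c5 c6 : R,
    veq xi (bachelier_field r sigma c1 c2 c3 c4 c5 c6 (fun _ _ => 0)).

Definition xi1 : vfield :=
  VField (fun t s c => 1) (fun t s c => 0) (fun t s c => 0).

Definition xi2 (r : R) : vfield :=
  VField (fun t s c => 0) (fun t s c => exp (r * t)) (fun t s c => 0).

Definition xi3 (r sigma : R) : vfield :=
  VField (fun t s c => 0)
         (fun t s c => exp (- r * t))
         (fun t s c => - (2 * exp (- r * t) * r * s * c / sigma ^ 2)).

Definition xi4 (r sigma : R) : vfield :=
  VField (fun t s c => - (exp (-2 * r * t) / (2 * r)))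
         (fun t s c => 1 / 2 * exp (-2 * r * t) * s)
         (fun t s c =>
            - (exp (-2 * r * t) * (sigma ^ 2 + r * s ^ 2) * c / sigma ^ 2)).

Definition xi5 (r : R) : vfield :=
  VField (fun t s c => exp (2 * r * t) / (2 * r))
         (fun t s c => 1 / 2 * exp (2 * r * t) * s)
         (fun t s c => 1 / 2 * exp (2 * r * t) * c).

Definition xi6 : vfield :=
  VField (fun t s c => 0) (fun t s c => 0) (fun t s c => c).

Definition G1 (eps : R) (q : point) : point :=
  let '(t, s, c) := q in (t + eps, s, c).

Definition G2 (r eps : R) (q : point) : point :=
  let '(t, s, c) := q in (t, s + eps * exp (r * t), c).

Definition G3 (r sigma eps : R) (q : point) : point :=
  let '(t, s, c) := q in
  (t, s + eps * exp (- r * t),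
   exp (- (eps * r * exp (- r * t) * (eps * exp (- r * t) + 2 * s)
           / sigma ^ 2)) * c).

Definition dom4 (r eps : R) (q : point) : Prop :=
  exp (2 * r * pt q) + eps > 0.

Definition G4 (r sigma eps : R) (q : point) : point :=
  let '(t, s, c) := q in
  let u := exp (2 * r * t) + eps in
  (ln u / (2 * r),
   exp (r * t) * s / sqrt u,
   exp (- (r * (2 * sigma ^ 2 * t * u - eps * s ^ 2) / (sigma ^ 2 * u)))
     * u * c).

Definition dom5 (r eps : R) (q : point) : Prop :=
  exp (-2 * r * pt q) + eps > 0.

Definition G5 (r eps : R) (q : point) : point :=
  let '(t, s, c) := q in
  let u := exp (-2 * r * t) + eps in
  (- (ln u / (2 * r)),
   exp (- r * t) * s / sqrt u,
   exp (- r * t) * c / sqrt u).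

Definition G6 (eps : R) (q : point) : point :=
  let '(t, s, c) := q in (t, s, exp eps * c).

(* Main.v *)
Require Import Defs.
From Stdlib Require Import Lra FunctionalExtensionality.

(** Write T, E, Z for the components of the vector field along t, S, C.

    Symmetries. On the hypersurface F = 0 the derivative C_t is a function of
    the other jet coordinates, which stay free. So [pr2_apply xi F] restricted
    to F = 0 is a polynomial in C_tS, C_SS, C_S that has to vanish identically.
    Its coefficients, read in this order, force T to depend on t alone, then E
    to be independent of C with T_t = 2 E_S, then Z to be affine in C, and leave
    two linear equations that couple Z with T and E. This is
    [symmetry_determining]. The determining equations integrate in S: E is
    affine in S and the coefficient of C in Z is quadratic in S, so everything
    is governed by functions of t with
      T''' = 4 r^2 T',   a'' = r^2 a,   b' = (3/2) r T' - T''/4,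
    where E = a + T' S / 2 and b is the part of the coefficient of C that does
    not depend on S ([determining_normal_form] and its converse
    [normal_form_determining]). The term of Z that does not involve C is a
    solution psi of the equation itself. Solving the three linear equations
    gives the six constants ([normal_form_bachelier_field]).

    Lie algebra. The bracket of two fields with psi = 0 is computed in
    [bracket_bachelier_field0]; it is again such a field, with structure
    constants bilinear in c1, ..., c6. In particular the fields with psi = 0
    have to be shown smooth, which holds because their components lie in an
    algebra of functions that is stable under partial derivatives
    ([elementary_smooth]).

    Flows. That the given maps solve the flow equations is a differentiation.
    Uniqueness and the maximality of the domain come from conserved quantities:
    along any integral curve three explicit functions of (lambda, t, S, C) are
    constant, and these determine the curve. For xi4 they are
      e^(2rt) + lambda,   S e^(rt),   C e^(-2rt + r S^2 / sigma^2),
    and the first one also shows that e^(2rt) - lambda, taken at the starting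
    point, stays positive, which is the domain of G4. Similarly for xi5, with
    e^(-2rt) + lambda, S e^(-rt) and C e^(-rt). The group parameter is lambda
    for xi1, xi2, xi3, xi6 and - lambda for xi4, xi5. *)

(** * Functions of one variable *)

Lemma conserved (J : R -> Prop) (f : R -> R) :
  open_interval_at_0 J -> (forall l, J l -> is_derive f l 0) ->
  forall l, J l -> f l = f 0.
Proof.
  intros (_ & J0 & HJ) H l Hl.
  destruct (Rtotal_order l 0) as [h|[->|h]]; [|reflexivity|].
  - apply (eq_is_derive f l 0); [|assumption].
    intros x Hx. apply H, (HJ l 0); assumption.
  - symmetry. apply (eq_is_derive f 0 l); [|assumption].
    intros x Hx. apply H, (HJ 0 l); assumption.
Qed.

Lemma open_interval_R : open_interval_at_0 (fun _ => True).
Proof. split; [apply open_true|]. split; [exact I|intros; exact I]. Qed.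

Lemma is_derive_0_const (f : R -> R) :
  (forall x, is_derive f x 0) -> forall x, f x = f 0.
Proof.
  intros H x. now apply (conserved (fun _ => True) f open_interval_R).
Qed.

(* Unfolding [is_derive] makes failing unifications very slow. *)
#[local] Opaque is_derive.

(** The next two tactics discharge what [auto_derive] leaves open about
    functions whose derivatives are given by hypotheses. *)
Ltac Derive_known :=
  repeat match goal with
  | |- context [Derive ?f ?x] =>
      erewrite (is_derive_unique f x)
        by (match goal with H : _ |- _ => apply H end)
  end.

Ltac ex_derive_known :=
  repeat split;
  try (eexists; match goal with H : _ |- _ => apply H end).

Lemma is_derive_linear (f : R -> R) (k : R) :
  (forall x, is_derive f x k) -> forall x, f x = f 0 + k * x.
Proof.
  intros H x.
  enough (e : f x - k * x = f 0) by lra.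
  rewrite (is_derive_0_const (fun y => f y - k * y)); [ring|].
  clear x; intro x. auto_derive; [ex_derive_known|].
  Derive_known.
  ring.
Qed.

(** The functions (y' + k y) e^(-kx) and (y' - k y) e^(kx) are constant, and
    two linear combinations of them recover y and y'. *)
Lemma hyperbolic_ode (k : R) (y z : R -> R) : k <> 0 ->
  (forall x, is_derive y x (z x)) ->
  (forall x, is_derive z x (k ^ 2 * y x)) ->
  exists A B, forall x, y x = A * exp (k * x) + B * exp (- k * x) /\
                        z x = k * (A * exp (k * x) - B * exp (- k * x)).
Proof.
  intros hk Hy Hz.
  assert (HP : forall x, (z x + k * y x) * exp (- k * x) = z 0 + k * y 0).
  { intro x. rewrite (is_derive_0_const (fun x => (z x + k * y x) * exp (- k * x))).
    - rewrite Rmult_0_r, exp_0. ring.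
    - clear x. intro x. auto_derive; [ex_derive_known|].
      Derive_known.
      ring. }
  assert (HN : forall x, (z x - k * y x) * exp (k * x) = z 0 - k * y 0).
  { intro x. rewrite (is_derive_0_const (fun x => (z x - k * y x) * exp (k * x))).
    - rewrite Rmult_0_r, exp_0. ring.
    - clear x. intro x. auto_derive; [ex_derive_known|].
      Derive_known.
      ring. }
  exists ((z 0 + k * y 0) / (2 * k)), (- (z 0 - k * y 0) / (2 * k)).
  intro x. rewrite <- (HP x), <- (HN x).
  replace (- k * x) with (- (k * x)) by ring. rewrite exp_Ropp.
  assert (exp (k * x) <> 0) by apply Rgt_not_eq, exp_pos.
  split; field; auto.
Qed.

(** Keeps the exponent A abstract, so that the rational identities that remain
    for G3 and G4 have the exponential as a common factor. *)
Lemma is_derive_exp_mult (A B : R -> R) dA dB l v :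
  is_derive A l dA -> is_derive B l dB -> v = exp (A l) * (dA * B l + dB) ->
  is_derive (fun x => exp (A x) * B x) l v.
Proof.
  intros HA HB ->. auto_derive; [ex_derive_known|Derive_known]. ring.
Qed.

(** * Exponentials of multiples of rt *)

Lemma exp_mul_nat x n : exp (INR n * x) = exp x ^ n.
Proof.
  induction n as [|n IH]; [now rewrite Rmult_0_l, exp_0|].
  rewrite S_INR, Rmult_plus_distr_r, Rmult_1_l, exp_plus, IH. cbn. ring.
Qed.

Lemma exp_pow_1 r t : exp (- r * t) = / exp (r * t).
Proof. rewrite <- exp_Ropp. f_equal. ring. Qed.

Lemma exp_pow_2 r t : exp (2 * r * t) = exp (r * t) ^ 2.
Proof. rewrite <- exp_mul_nat. f_equal. cbn; ring. Qed.

Lemma exp_pow_m2 r t : exp (-2 * r * t) = / exp (r * t) ^ 2.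
Proof. rewrite <- exp_pow_2, <- exp_Ropp. f_equal. ring. Qed.

Lemma exp_pow_m2' r t : exp (- (2 * r) * t) = / exp (r * t) ^ 2.
Proof. rewrite <- exp_pow_m2. f_equal. ring. Qed.

Lemma exp_pow_3 r t : exp (3 * r * t) = exp (r * t) ^ 3.
Proof. rewrite <- exp_mul_nat. f_equal. cbn; ring. Qed.

Lemma exp_pow_4 r t : exp (4 * r * t) = exp (r * t) ^ 4.
Proof. rewrite <- exp_mul_nat. f_equal. cbn; ring. Qed.

(** Turns the exponentials into powers of exp (r * t), after which identities
    between them are identities of rational functions. *)
Ltac exp_powers :=
  rewrite ?exp_pow_1, ?exp_pow_2, ?exp_pow_m2, ?exp_pow_m2', ?exp_pow_3,
    ?exp_pow_4.

Ltac field_exp :=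
  field; repeat split; first [assumption | lra | apply Rgt_not_eq, exp_pos].

(** * Smooth functions of three variables *)

Definition d1 (f : R -> R -> R -> R) : R -> R -> R -> R :=
  fun t s c => Derive (fun x => f x s c) t.
Definition d2 (f : R -> R -> R -> R) : R -> R -> R -> R :=
  fun t s c => Derive (fun x => f t x c) s.
Definition d3 (f : R -> R -> R -> R) : R -> R -> R -> R :=
  fun t s c => Derive (fun x => f t s x) c.

Lemma smooth3_d1 f : smooth3 f -> smooth3 (d1 f).
Proof. intros H k; destruct (H (S k)) as (_ & _ & _ & h1 & h2 & h3); assumption. Qed.
Lemma smooth3_d2 f : smooth3 f -> smooth3 (d2 f).
Proof. intros H k; destruct (H (S k)) as (_ & _ & _ & h1 & h2 & h3); assumption. Qed.
Lemma smooth3_d3 f : smooth3 f -> smooth3 (d3 f).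
Proof. intros H k; destruct (H (S k)) as (_ & _ & _ & h1 & h2 & h3); assumption. Qed.

Lemma smooth3_ex1 f t s c : smooth3 f -> ex_derive (fun x => f x s c) t.
Proof. intros H; destruct (H 1%nat) as (h & _); apply h. Qed.
Lemma smooth3_ex2 f t s c : smooth3 f -> ex_derive (fun x => f t x c) s.
Proof. intros H; destruct (H 1%nat) as (_ & h & _); apply h. Qed.
Lemma smooth3_ex3 f t s c : smooth3 f -> ex_derive (fun x => f t s x) c.
Proof. intros H; destruct (H 1%nat) as (_ & _ & h & _); apply h. Qed.

#[local] Hint Resolve smooth3_d1 smooth3_d2 smooth3_d3
  smooth3_ex1 smooth3_ex2 smooth3_ex3 : smooth.

Lemma d2_zero f : (forall t s c, f t s c = 0) -> forall t s c, d2 f t s c = 0.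
Proof.
  intros H t s c. unfold d2. rewrite <- (Derive_const 0 s).
  apply Derive_ext; auto.
Qed.
Lemma d3_zero f : (forall t s c, f t s c = 0) -> forall t s c, d3 f t s c = 0.
Proof.
  intros H t s c. unfold d3. rewrite <- (Derive_const 0 c).
  apply Derive_ext; auto.
Qed.

Lemma const2 f : smooth3 f -> (forall t s c, d2 f t s c = 0) ->
  forall t s c, f t s c = f t 0 c.
Proof.
  intros Hf H t s c. apply (is_derive_0_const (fun x => f t x c)). intro x.
  rewrite <- (H t x c). apply Derive_correct, smooth3_ex2, Hf.
Qed.

Lemma const3 f : smooth3 f -> (forall t s c, d3 f t s c = 0) ->
  forall t s c, f t s c = f t s 0.
Proof.
  intros Hf H t s c. apply (is_derive_0_const (fun x => f t s x)). intro x.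
  rewrite <- (H t s x). apply Derive_correct, smooth3_ex3, Hf.
Qed.

(** Supplies the smoothness of psi, which is the restriction of a component of
    the field to C = 0. *)
Lemma smooth2_slice f c : smooth3 f -> smooth2 (fun t s => f t s c).
Proof.
  intros H k. specialize (H k). revert f H.
  induction k as [|k IH]; intros f H.
  - intros t s.
    apply (continuous_comp (fun p : R * R => (p, c))
      (fun p : R * R * R => f (fst (fst p)) (snd (fst p)) (snd p))).
    + intros P HP. destruct HP as [eps HP]. exists eps.
      intros p Hp. apply HP. split; [exact Hp|apply ball_center].
    + apply H.
  - destruct H as (h1 & h2 & _ & h4 & h5 & _).
    split; [intros; apply h1|]. split; [intros; apply h2|].
    split; [apply (IH (d1 f))|apply (IH (d2 f))]; assumption.
Qed.

Lemma veq_eq xi eta : veq xi eta -> xi = eta.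
Proof.
  destruct xi, eta; intro H; f_equal;
    repeat (apply functional_extensionality; intro); apply H.
Qed.

(** * The second prolongation applied to the Bachelier equation *)

Lemma Dt_lift f p :
  Dt (lift f) p = d1 f (p Jt) (p JS) (p JC) + p JCt * d3 f (p Jt) (p JS) (p JC).
Proof.
  unfold Dt, pd, lift, upd; cbn. rewrite !Derive_const. unfold d1, d3. ring.
Qed.

Lemma DS_lift f p :
  DS (lift f) p = d2 f (p Jt) (p JS) (p JC) + p JCS * d3 f (p Jt) (p JS) (p JC).
Proof.
  unfold DS, pd, lift, upd; cbn. rewrite !Derive_const. unfold d2, d3. ring.
Qed.

Lemma phi_t_lift xi p (t := p Jt) (s := p JS) (c := p JC) :
  phi_t xi p =
    d1 (vc xi) t s c + p JCt * d3 (vc xi) t s c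
    - p JCt * (d1 (vt xi) t s c + p JCt * d3 (vt xi) t s c)
    - p JCS * (d1 (vs xi) t s c + p JCt * d3 (vs xi) t s c).
Proof. unfold phi_t. rewrite !Dt_lift. reflexivity. Qed.

Lemma phi_S_lift xi p (t := p Jt) (s := p JS) (c := p JC) :
  phi_S xi p =
    d2 (vc xi) t s c + p JCS * d3 (vc xi) t s c
    - p JCt * (d2 (vt xi) t s c + p JCS * d3 (vt xi) t s c)
    - p JCS * (d2 (vs xi) t s c + p JCS * d3 (vs xi) t s c).
Proof. unfold phi_S. rewrite !DS_lift. reflexivity. Qed.

(** The dependence of phi_S on each of the variables S and C, with the jet
    coordinates u = C_t and v = C_S frozen. *)
Lemma Derive_phi_S_shape (a b e f g h : R -> R) (u v x : R) :
  ex_derive a x -> ex_derive b x -> ex_derive e x ->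
  ex_derive f x -> ex_derive g x -> ex_derive h x ->
  Derive (fun y => a y + v * b y - u * (e y + v * f y) - v * (g y + v * h y)) x
  = Derive a x + v * Derive b x - u * (Derive e x + v * Derive f x)
    - v * (Derive g x + v * Derive h x).
Proof.
  intros. apply is_derive_unique. auto_derive; [tauto|].
  change (Derive (fun x => ?k x)) with (Derive k). ring.
Qed.

(** Both orders of the mixed derivatives occur; the one equation in which they
    survive is symmetric in them. *)
Lemma phi_SS_lift xi p (t := p Jt) (s := p JS) (c := p JC)
    (T := vt xi) (E := vs xi) (Z := vc xi) :
  smooth_field xi ->
  phi_SS xi p =
    d2 (d2 Z) t s c + p JCS * d2 (d3 Z) t s c
    - p JCt * (d2 (d2 T) t s c + p JCS * d2 (d3 T) t s c)
    - p JCS * (d2 (d2 E) t s c + p JCS * d2 (d3 E) t s c)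
    + p JCS *
      (d3 (d2 Z) t s c + p JCS * d3 (d3 Z) t s c
       - p JCt * (d3 (d2 T) t s c + p JCS * d3 (d3 T) t s c)
       - p JCS * (d3 (d2 E) t s c + p JCS * d3 (d3 E) t s c))
    - 2 * p JCtS * (d2 T t s c + p JCS * d3 T t s c)
    + p JCSS * (d3 Z t s c - p JCt * d3 T t s c
                - 2 * d2 E t s c - 3 * p JCS * d3 E t s c).
Proof.
  intros [HT [HE HZ]].
  unfold phi_SS. rewrite !DS_lift.
  replace (phi_S xi) with
    (fun p : jet => d2 Z (p Jt) (p JS) (p JC) + p JCS * d3 Z (p Jt) (p JS) (p JC)
    - p JCt * (d2 T (p Jt) (p JS) (p JC) + p JCS * d3 T (p Jt) (p JS) (p JC))
    - p JCS * (d2 E (p Jt) (p JS) (p JC) + p JCS * d3 E (p Jt) (p JS) (p JC)))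
    by (apply functional_extensionality; intro; now rewrite phi_S_lift).
  unfold DS, pd, upd; cbn.
  rewrite (Derive_phi_S_shape (fun x => d2 Z (p Jt) x (p JC))
    (fun x => d3 Z (p Jt) x (p JC)) (fun x => d2 T (p Jt) x (p JC))
    (fun x => d3 T (p Jt) x (p JC)) (fun x => d2 E (p Jt) x (p JC))
    (fun x => d3 E (p Jt) x (p JC))) by auto with smooth.
  rewrite (Derive_phi_S_shape (d2 Z (p Jt) (p JS))
    (d3 Z (p Jt) (p JS)) (d2 T (p Jt) (p JS))
    (d3 T (p Jt) (p JS)) (d2 E (p Jt) (p JS))
    (d3 E (p Jt) (p JS))) by (apply smooth3_ex3; auto with smooth).
  erewrite (is_derive_unique _ (p JCt)); cycle 1.
  { auto_derive; [easy|reflexivity]. }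
  erewrite (is_derive_unique _ (p JCS)); cycle 1.
  { auto_derive; [easy|reflexivity]. }
  unfold d2, d3, t, s, c, T, E, Z.
  ring.
Qed.

Lemma pr2_bachelier r sigma xi p :
  pr2_apply xi (bachelier r sigma) p =
    r * p JCS * vs xi (p Jt) (p JS) (p JC) + r * p JS * phi_S xi p
    + 1 / 2 * sigma ^ 2 * phi_SS xi p + phi_t xi p
    - r * vc xi (p Jt) (p JS) (p JC).
Proof.
  unfold pr2_apply, pr2.
  assert (H : forall i k, (forall x, is_derive
      (fun x => bachelier r sigma (upd p i x)) x k) ->
      pd i (bachelier r sigma) p = k).
  { intros i k H. apply is_derive_unique, H. }
  rewrite (H Jt 0), (H JS (r * p JCS)), (H JC (- r)), (H JCt 1),
    (H JCS (r * p JS)), (H JCtt 0), (H JCtS 0), (H JCSS (1 / 2 * sigma ^ 2));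
  try (intro x; unfold bachelier, upd; cbn; auto_derive; [easy|field]).
  unfold lift. ring.
Qed.

(** The second t-derivative of C does not occur in pr^2 xi F, hence the 0. *)
Definition mkjet (t s c ut us uts uss : R) : jet := fun i =>
  match i with
  | Jt => t | JS => s | JC => c | JCt => ut | JCS => us
  | JCtt => 0 | JCtS => uts | JCSS => uss
  end.

(** The coefficients of the monomials C_tS, C_tS C_S, C_SS C_S, C_SS, C_S^2,
    C_S and 1, in this order, each simplified by the preceding ones. *)
Definition determining (r sigma : R) (xi : vfield) : Prop :=
  let T := vt xi in let E := vs xi in let Z := vc xi in
  forall t s c,
    d2 T t s c = 0 /\ d3 T t s c = 0 /\ d3 E t s c = 0 /\
    d1 T t s c = 2 * d2 E t s c /\ d3 (d3 Z) t s c = 0 /\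
    1 / 2 * sigma ^ 2 * (d2 (d3 Z) t s c + d3 (d2 Z) t s c)
      = d1 E t s c - r * E t s c - r * s * d2 E t s c /\
    r * s * d2 Z t s c + 1 / 2 * sigma ^ 2 * d2 (d2 Z) t s c + d1 Z t s c
      + r * c * (d3 Z t s c - d1 T t s c) - r * Z t s c = 0.

(** Once T depends on t alone, C_tS drops out. *)
Lemma pr2_bachelier_T r sigma xi p (t := p Jt) (s := p JS) (c := p JC)
    (T := vt xi) (E := vs xi) (Z := vc xi) (v := p JCS) :
  smooth_field xi ->
  (forall t s c, d2 T t s c = 0) -> (forall t s c, d3 T t s c = 0) ->
  pr2_apply xi (bachelier r sigma) p =
    r * v * E t s c
    + r * s * (d2 Z t s c + v * d3 Z t s c - v * (d2 E t s c + v * d3 E t s c))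
    + 1 / 2 * sigma ^ 2 *
      (d2 (d2 Z) t s c + v * d2 (d3 Z) t s c
       - v * (d2 (d2 E) t s c + v * d2 (d3 E) t s c)
       + v * (d3 (d2 Z) t s c + v * d3 (d3 Z) t s c
              - v * (d3 (d2 E) t s c + v * d3 (d3 E) t s c))
       + p JCSS * (d3 Z t s c - 2 * d2 E t s c - 3 * v * d3 E t s c))
    + (d1 Z t s c + p JCt * d3 Z t s c - p JCt * d1 T t s c
       - v * (d1 E t s c + p JCt * d3 E t s c))
    - r * Z t s c.
Proof.
  intros Hs T2 T3.
  rewrite pr2_bachelier, phi_t_lift, phi_S_lift, phi_SS_lift by assumption.
  fold T E Z t s c.
  rewrite (d2_zero _ T2), (d2_zero _ T3), (d3_zero _ T2), (d3_zero _ T3), T2, T3.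
  unfold v. ring.
Qed.

(** The relations T_S = T_C = E_C = 0 and T_t = 2 E_S make E affine in S, so all
    its second derivatives in S and C vanish; what remains is quadratic in C_S,
    up to a multiple of the combination of C_t and C_SS known from F = 0. *)
Lemma pr2_bachelier_TE r sigma xi p (t := p Jt) (s := p JS) (c := p JC)
    (T := vt xi) (E := vs xi) (Z := vc xi) (v := p JCS) :
  smooth_field xi ->
  (forall t s c, d2 T t s c = 0) -> (forall t s c, d3 T t s c = 0) ->
  (forall t s c, d3 E t s c = 0) -> (forall t s c, d1 T t s c = 2 * d2 E t s c) ->
  pr2_apply xi (bachelier r sigma) p =
    (r * s * d2 Z t s c + 1 / 2 * sigma ^ 2 * d2 (d2 Z) t s c + d1 Z t s c
     - r * Z t s c)
    + v * (r * E t s c + r * s * (d3 Z t s c - d2 E t s c)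
           + 1 / 2 * sigma ^ 2 * (d2 (d3 Z) t s c + d3 (d2 Z) t s c)
           - d1 E t s c)
    + v ^ 2 * (1 / 2 * sigma ^ 2 * d3 (d3 Z) t s c)
    + (p JCt + 1 / 2 * sigma ^ 2 * p JCSS) * (d3 Z t s c - d1 T t s c).
Proof.
  intros Hs T2 T3 E3 E2.
  assert (E2' : forall t s c, d2 E t s c = / 2 * d1 T t 0 0).
  { intros t' s' c'.
    assert (e : d1 T t' s' c' = d1 T t' 0 0).
    { unfold d1. apply Derive_ext. intro x.
      rewrite (const3 T), (const2 T); trivial; apply Hs. }
    generalize (E2 t' s' c'). lra. }
  assert (E22 : d2 (d2 E) t s c = 0).
  { unfold d2 at 1. rewrite <- (Derive_const (/ 2 * d1 T t 0 0) s).
    apply Derive_ext; intro x. apply E2'. }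
  assert (E32 : d3 (d2 E) t s c = 0).
  { unfold d3. rewrite <- (Derive_const (/ 2 * d1 T t 0 0) c).
    apply Derive_ext; intro x. apply E2'. }
  rewrite pr2_bachelier_T by assumption. fold T E Z t s c v.
  rewrite (d2_zero _ E3), (d3_zero _ E3), E22, E32, E3, (E2 t s c). ring.
Qed.

(** The equation F = 0 is solved for C_t and leaves the other coordinates free,
    so each coefficient can be isolated by subtracting values at jets that
    differ in one coordinate. *)
Lemma symmetry_determining r sigma xi : sigma <> 0 -> smooth_field xi ->
  lie_point_symmetry (bachelier r sigma) xi <-> determining r sigma xi.
Proof.
  intros hsigma Hs.
  assert (hs2 : sigma ^ 2 <> 0) by now apply pow_nonzero.
  set (T := vt xi). set (E := vs xi). set (Z := vc xi).
  split.
  - intros H.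
    (* the jets on F = 0: C_t is expressed by the other coordinates *)
    set (J t s c us uts uss := mkjet t s c
      (r * c - r * s * us - 1 / 2 * sigma ^ 2 * uss) us uts uss).
    assert (Q : forall t s c us uts uss,
      pr2_apply xi (bachelier r sigma) (J t s c us uts uss) = 0).
    { intros. apply H. unfold bachelier; cbn. ring. }
    (* the coefficient of C_tS *)
    assert (QT : forall t s c us, d2 T t s c + us * d3 T t s c = 0).
    { intros t s c us. apply (Rmult_eq_reg_l (sigma ^ 2)); [|assumption].
      generalize (Q t s c us 0 0) (Q t s c us 1 0).
      rewrite !pr2_bachelier, !phi_t_lift, !phi_S_lift, !phi_SS_lift by assumption.
      cbn -[pow]. fold T E Z. lra. }
    assert (T2 : forall t s c, d2 T t s c = 0).
    { intros t s c. generalize (QT t s c 0). lra. }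
    assert (T3 : forall t s c, d3 T t s c = 0).
    { intros t s c. generalize (QT t s c 1) (T2 t s c). lra. }
    (* the coefficient of C_SS *)
    assert (QE : forall t s c us,
      d1 T t s c - 2 * d2 E t s c - 2 * us * d3 E t s c = 0).
    { intros t s c us. apply (Rmult_eq_reg_l (1 / 2 * sigma ^ 2)); [|lra].
      generalize (Q t s c us 0 0) (Q t s c us 0 1).
      rewrite !pr2_bachelier_T by assumption. cbn -[pow]. fold T E Z. lra. }
    assert (E3 : forall t s c, d3 E t s c = 0).
    { intros t s c. generalize (QE t s c 0) (QE t s c 1). lra. }
    assert (E2 : forall t s c, d1 T t s c = 2 * d2 E t s c).
    { intros t s c. generalize (QE t s c 0). lra. }
    (* the coefficients of C_S^2, C_S and 1 *)
    intros t s c. generalize (Q t s c 0 0 0) (Q t s c 1 0 0) (Q t s c (-1) 0 0).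
    rewrite !pr2_bachelier_TE by assumption. cbn -[pow]. fold T E Z.
    intros q0 q1 q2.
    split; [apply T2|]. split; [apply T3|]. split; [apply E3|].
    split; [apply E2|]. split.
    + apply (Rmult_eq_reg_l (sigma ^ 2)); [|assumption]. lra.
    + rewrite (E2 t s c) in *. split; lra.
  - intros H p Hp.
    rewrite pr2_bachelier_TE by (trivial; intros; apply H).
    fold T E Z.
    destruct (H (p Jt) (p JS) (p JC)) as (_ & _ & _ & e1 & e2 & e3 & e4).
    fold T E Z in e1, e2, e3, e4.
    assert (Hut : p JCt + 1 / 2 * sigma ^ 2 * p JCSS
                  = r * p JC - r * p JS * p JCS)
      by (unfold bachelier in Hp; lra).
    rewrite Hut, e2, e3. rewrite e1 in *. lra.
Qed.

(** * Integration of the determining equations *)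

(** tau1, tau2 are the first two derivatives of tau, and a1 is the derivative of
    a. The quadratic polynomial in S that multiplies C is the primitive of
    sigma^-2 (E_t - r E - r S E_S), with constant of integration b. *)
Definition normal_form (r sigma : R) (xi : vfield) (tau tau1 tau2 a a1 b : R -> R)
    (psi : R -> R -> R) : Prop :=
  (forall t, is_derive tau t (tau1 t)) /\
  (forall t, is_derive tau1 t (tau2 t)) /\
  (forall t, is_derive tau2 t (4 * r ^ 2 * tau1 t)) /\
  (forall t, is_derive a t (a1 t)) /\
  (forall t, is_derive a1 t (r ^ 2 * a t)) /\
  (forall t, is_derive b t (3 / 2 * r * tau1 t - / 4 * tau2 t)) /\
  solution (bachelier r sigma) psi /\
  veq xi (VField
    (fun t s c => tau t)
    (fun t s c => a t + / 2 * tau1 t * s)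
    (fun t s c => (b t + / sigma ^ 2 * ((a1 t - r * a t) * s
                     + (/ 4 * tau2 t - / 2 * r * tau1 t) * s ^ 2)) * c
                  + psi t s)).

(** Since Z is affine in C, both mixed derivatives Z_SC, Z_CS equal the
    S-derivative of the coefficient al of C; the first coupled equation then
    says that al is quadratic in S. In the second one the part that is free of C
    is the Bachelier equation for psi, and the coefficient of C is a polynomial
    in S whose three coefficients are the differential equations for tau, a
    and b. *)
Lemma determining_normal_form r sigma xi : sigma <> 0 -> smooth_field xi ->
  determining r sigma xi ->
  exists tau tau1 tau2 a a1 b psi,
    normal_form r sigma xi tau tau1 tau2 a a1 b psi.
Proof.
  intros hsigma [HT [HE HZ]] H. unfold determining in H.
  destruct xi as [T E Z]; cbn in *.
  assert (hs2 : sigma ^ 2 <> 0) by now apply pow_nonzero.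
  set (al := fun t s => d3 Z t s 0). set (be := fun t s => Z t s 0).
  assert (eT : forall t s c, T t s c = T t 0 0).
  { intros. rewrite (const3 T), (const2 T); trivial; intros; apply H. }
  assert (eT1 : forall t s c, d1 T t s c = d1 T t 0 0).
  { intros. unfold d1. apply Derive_ext; intro; apply eT. }
  assert (eE : forall t s c, E t s c = E t 0 0 + / 2 * d1 T t 0 0 * s).
  { intros t s c. rewrite (const3 E) by (trivial; intros; apply H).
    apply (is_derive_linear (fun y => E t y 0)). intro y.
    replace (/ 2 * d1 T t 0 0) with (d2 E t y 0).
    - apply Derive_correct, smooth3_ex2, HE.
    - destruct (H t y 0) as (_ & _ & _ & e & _). rewrite eT1 in e. lra. }
  assert (eE1 : forall t s c,
    d1 E t s c = d1 E t 0 0 + / 2 * d1 (d1 T) t 0 0 * s).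
  { intros t s c. unfold d1 at 1. apply is_derive_unique.
    apply (is_derive_ext (fun x => E x 0 0 + / 2 * d1 T x 0 0 * s)).
    { intro; now rewrite (eE _ s c). }
    auto_derive; [auto with smooth|]. unfold d1. ring. }
  assert (eZ : forall t s c, Z t s c = be t s + al t s * c).
  { intros t s c. apply (is_derive_linear (Z t s)). intro y.
    replace (al t s) with (d3 Z t s y).
    - apply Derive_correct, smooth3_ex3, HZ.
    - apply (const3 (d3 Z)); [auto with smooth|apply H]. }
  assert (eZ23 : forall t s c, d2 (d3 Z) t s c = d2 (d3 Z) t s 0).
  { intros t s c. apply Derive_ext; intro y.
    apply (const3 (d3 Z)); [auto with smooth|apply H]. }
  assert (eZ2 : forall t s c, d2 Z t s c = d2 Z t s 0 + d2 (d3 Z) t s 0 * c).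
  { intros t s c. apply is_derive_unique.
    apply (is_derive_ext (fun x => be t x + al t x * c)).
    { intro; now rewrite eZ. }
    unfold be, al. auto_derive; [auto with smooth|]. unfold d2. ring. }
  assert (eZ32 : forall t s c, d3 (d2 Z) t s c = d2 (d3 Z) t s 0).
  { intros t s c. apply is_derive_unique.
    apply (is_derive_ext (fun x => d2 Z t s 0 + d2 (d3 Z) t s 0 * x)).
    { intro; symmetry; apply eZ2. }
    auto_derive; [easy|ring]. }
  set (a := fun t => E t 0 0). set (a1 := fun t => d1 E t 0 0).
  set (tau1 := fun t => d1 T t 0 0). set (tau2 := fun t => d1 (d1 T) t 0 0).
  set (b := fun t => d3 Z t 0 0).
  assert (eZ3 : forall t s, d2 (d3 Z) t s 0 = / sigma ^ 2 *
    ((a1 t - r * a t) + 2 * (/ 4 * tau2 t - / 2 * r * tau1 t) * s)).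
  { intros t s. apply (Rmult_eq_reg_l (sigma ^ 2)); [|assumption].
    destruct (H t s 0) as (_ & _ & _ & e1 & _ & e2 & _).
    rewrite eZ32, eE1, eE in e2. assert (e3 : d2 E t s 0 = / 2 * d1 T t 0 0) by (rewrite eT1 in e1; lra).
    rewrite e3 in e2.
    rewrite <- Rmult_assoc, Rinv_r, Rmult_1_l by assumption.
    unfold a, a1, tau1, tau2. lra. }
  assert (ea : forall t s, al t s = b t + / sigma ^ 2 * ((a1 t - r * a t) * s
                     + (/ 4 * tau2 t - / 2 * r * tau1 t) * s ^ 2)).
  { intros t s.
    enough (e : al t s - / sigma ^ 2 * ((a1 t - r * a t) * s
                  + (/ 4 * tau2 t - / 2 * r * tau1 t) * s ^ 2) = b t) by lra.
    rewrite (is_derive_0_const (fun s => al t s - / sigma ^ 2 *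
      ((a1 t - r * a t) * s + (/ 4 * tau2 t - / 2 * r * tau1 t) * s ^ 2))).
    { unfold al, b. ring. }
    clear s. intro s. unfold al. auto_derive; [auto with smooth|].
    change (Derive (fun x => d3 Z t x 0) s) with (d2 (d3 Z) t s 0).
    rewrite eZ3. now field. }
  assert (eZ1 : forall t s c, d1 Z t s c = d1 Z t s 0 + d1 (d3 Z) t s 0 * c).
  { intros t s c. apply is_derive_unique.
    apply (is_derive_ext (fun x => be x s + al x s * c)).
    { intro; now rewrite eZ. }
    unfold be, al. auto_derive; [auto with smooth|]. unfold d1. ring. }
  assert (eZ22 : forall t s c, d2 (d2 Z) t s c = d2 (d2 Z) t s 0
    + 2 * (/ sigma ^ 2 * (/ 4 * tau2 t - / 2 * r * tau1 t)) * c).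
  { intros t s c. apply is_derive_unique.
    apply (is_derive_ext (fun x => d2 Z t x 0 + / sigma ^ 2 *
      ((a1 t - r * a t) + 2 * (/ 4 * tau2 t - / 2 * r * tau1 t) * x) * c)).
    { intro; now rewrite (eZ2 t _ c), eZ3. }
    auto_derive; [auto with smooth|]. unfold d2. now field. }
  assert (eZ31 : forall t s, d1 (d3 Z) t s 0 = d1 (d3 Z) t 0 0
    + / sigma ^ 2 * ((d1 (d1 E) t 0 0 - r * a1 t) * s
        + (/ 4 * d1 (d1 (d1 T)) t 0 0 - / 2 * r * tau2 t) * s ^ 2)).
  { intros t s. apply is_derive_unique. apply (is_derive_ext _ _ _ _ (fun t => eq_sym (ea t s))).
    unfold b, a1, a, tau1, tau2. auto_derive; [repeat split; auto with smooth|].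
    unfold d1. now field. }
  (* the coefficient of C in the last determining equation *)
  assert (Q : forall t s,
    (d1 (d3 Z) t 0 0 - r * tau1 t + (/ 4 * tau2 t - / 2 * r * tau1 t))
    + / sigma ^ 2 * ((d1 (d1 E) t 0 0 - r ^ 2 * a t) * s
       + (/ 4 * d1 (d1 (d1 T)) t 0 0 - r ^ 2 * tau1 t) * s ^ 2) = 0).
  { intros t s.
    destruct (H t s 0) as (_ & _ & _ & _ & _ & _ & e0).
    destruct (H t s 1) as (_ & _ & _ & _ & _ & _ & e1).
    rewrite eZ1, eZ2, eZ22, eZ, (const3 (d3 Z)), eT1 in e1
      by (auto with smooth; apply H).
    fold (tau1 t) in e1. fold (al t s) in e1. fold (be t s) in e0.
    rewrite eZ31, eZ3 in e1.
    assert (e2 : 1 / 2 * sigma ^ 2 *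
      (2 * (/ sigma ^ 2 * (/ 4 * tau2 t - / 2 * r * tau1 t)))
      = / 4 * tau2 t - / 2 * r * tau1 t) by now field.
    lra. }
  assert (Qb : forall t, d1 (d3 Z) t 0 0 = 3 / 2 * r * tau1 t - / 4 * tau2 t).
  { intro t. generalize (Q t 0). lra. }
  assert (hi : / sigma ^ 2 <> 0) by now apply Rinv_neq_0_compat.
  assert (Qa : forall t, d1 (d1 E) t 0 0 = r ^ 2 * a t).
  { intro t. generalize (Q t 1) (Q t (-1)) (Qb t). intros q1 q2 q3.
    apply (Rmult_eq_reg_l (/ sigma ^ 2)); [lra|assumption]. }
  assert (Qt : forall t, d1 (d1 (d1 T)) t 0 0 = 4 * r ^ 2 * tau1 t).
  { intro t. generalize (Q t 1) (Q t (-1)) (Qb t). intros q1 q2 q3.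
    apply (Rmult_eq_reg_l (/ sigma ^ 2)); [lra|assumption]. }
  exists (fun t => T t 0 0), tau1, tau2, a, a1, b, be.
  split; [intro; apply Derive_correct; auto with smooth|].
  split; [intro; apply (Derive_correct (fun x => d1 T x 0 0)), smooth3_ex1;
            auto with smooth|].
  split; [intro; rewrite <- Qt; apply (Derive_correct
            (fun x => d1 (d1 T) x 0 0)), smooth3_ex1; auto with smooth|].
  split; [intro; apply (Derive_correct (fun x => E x 0 0)), smooth3_ex1;
            auto with smooth|].
  split; [intro; rewrite <- Qa; apply (Derive_correct
            (fun x => d1 E x 0 0)), smooth3_ex1; auto with smooth|].
  split; [intro; rewrite <- Qb; apply (Derive_correct
            (fun x => d3 Z x 0 0)), smooth3_ex1; auto with smooth|].
  split; [split|].
  - now apply smooth2_slice.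
  - intros t s. destruct (H t s 0) as (_ & _ & _ & _ & _ & _ & e).
    unfold bachelier; cbn -[pow].
    change (r * s * d2 Z t s 0 + 1 / 2 * sigma ^ 2 * d2 (d2 Z) t s 0
      + d1 Z t s 0 - r * Z t s 0 = 0). lra.
  - intros t s c; cbn -[pow]. repeat split.
    + apply eT.
    + rewrite eE. reflexivity.
    + rewrite eZ, ea. ring.
Qed.

Lemma normal_form_determining r sigma xi tau tau1 tau2 a a1 b psi :
  sigma <> 0 -> normal_form r sigma xi tau tau1 tau2 a a1 b psi ->
  determining r sigma xi.
Proof.
  intros hsigma (Ht & Ht1 & Ht2 & Ha & Ha1 & Hb & [Hs Hpsi] & e).
  apply veq_eq in e. subst xi.
  set (psi_t := fun t s => Derive (fun x => psi x s) t).
  set (psi_s := fun t s => Derive (fun y => psi t y) s).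
  set (psi_ss := fun t s => Derive (fun y => psi_s t y) s).
  assert (Pt : forall t s, is_derive (fun x => psi x s) t (psi_t t s)).
  { intros. apply Derive_correct. destruct (Hs 1%nat) as (h & _). apply h. }
  assert (Ps : forall t s, is_derive (fun y => psi t y) s (psi_s t s)).
  { intros. apply Derive_correct. destruct (Hs 1%nat) as (_ & h & _). apply h. }
  assert (Pss : forall t s, is_derive (fun y => psi_s t y) s (psi_ss t s)).
  { intros. apply Derive_correct.
    destruct (Hs 2%nat) as (_ & _ & _ & _ & h & _). apply h. }
  assert (P : forall t s, r * s * psi_s t s + 1 / 2 * sigma ^ 2 * psi_ss t s
    + psi_t t s - r * psi t s = 0) by exact Hpsi.
  (* only the derivatives of psi that occur in the equation matter now *)
  clearbody psi_t psi_s psi_ss. clear Hpsi Hs.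
  unfold determining; cbn [vt vs vc].
  set (T := fun t _ _ : R => tau t).
  set (E := fun t s _ : R => a t + / 2 * tau1 t * s).
  set (w := / sigma ^ 2).
  set (Z := fun t s c : R =>
    (b t + w * ((a1 t - r * a t) * s
                + (/ 4 * tau2 t - / 2 * r * tau1 t) * s ^ 2)) * c + psi t s).
  set (k := fun t => / 4 * tau2 t - / 2 * r * tau1 t).
  assert (Hw : sigma ^ 2 * w = 1) by (unfold w; now field).
  clearbody w.
  assert (T1 : forall t s c, d1 T t s c = tau1 t).
  { intros. now apply is_derive_unique. }
  assert (E1 : forall t s c, d1 E t s c = a1 t + / 2 * tau2 t * s).
  { intros t s c. apply is_derive_unique. unfold E.
    auto_derive; [ex_derive_known|]. Derive_known. ring. }
  assert (E2 : forall t s c, d2 E t s c = / 2 * tau1 t).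
  { intros t s c. apply is_derive_unique. unfold E.
    auto_derive; [easy|]. ring. }
  assert (Z1 : forall t s c, d1 Z t s c =
    ((3 / 2 * r * tau1 t - / 4 * tau2 t) +
      w * ((r ^ 2 * a t - r * a1 t) * s
           + (r ^ 2 * tau1 t - / 2 * r * tau2 t) * s ^ 2)) * c + psi_t t s).
  { intros t s c. apply is_derive_unique. unfold Z, k.
    auto_derive; [ex_derive_known|]. Derive_known. field. }
  assert (Z2 : d2 Z = fun t s c =>
    w * (a1 t - r * a t + 2 * k t * s) * c + psi_s t s).
  { do 3 (apply functional_extensionality; intro).
    apply is_derive_unique. unfold Z, k.
    auto_derive; [ex_derive_known|]. Derive_known. field. }
  assert (Z3 : d3 Z = fun t s c =>
    b t + w * ((a1 t - r * a t) * s + k t * s ^ 2)).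
  { do 3 (apply functional_extensionality; intro).
    apply is_derive_unique. unfold Z, k. auto_derive; [easy|]. field. }
  assert (Z22 : forall t s c, d2 (d2 Z) t s c = 2 * w * k t * c + psi_ss t s).
  { intros t s c. rewrite Z2. apply is_derive_unique.
    auto_derive; [ex_derive_known|]. Derive_known. ring. }
  assert (Z32 : forall t s c,
    d3 (d2 Z) t s c = w * (a1 t - r * a t + 2 * k t * s)).
  { intros t s c. rewrite Z2. apply is_derive_unique.
    auto_derive; [easy|]. ring. }
  assert (Z23 : forall t s c,
    d2 (d3 Z) t s c = w * (a1 t - r * a t + 2 * k t * s)).
  { intros t s c. rewrite Z3. apply is_derive_unique.
    auto_derive; [easy|]. ring. }
  intros t s c. rewrite T1, E1, E2, Z1, Z22, Z32, Z23.
  repeat split.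
  - exact (Derive_const (tau t) s).
  - exact (Derive_const (tau t) c).
  - exact (Derive_const (a t + / 2 * tau1 t * s) c).
  - field.
  - rewrite Z3. unfold d3. apply Derive_const.
  - transitivity (sigma ^ 2 * w * (a1 t - r * a t + 2 * k t * s)); [field|].
    rewrite Hw. unfold E, k. field.
  - rewrite Z2, Z3.
    transitivity ((r * s * psi_s t s + 1 / 2 * sigma ^ 2 * psi_ss t s
      + psi_t t s - r * psi t s) + (sigma ^ 2 * w - 1) * k t * c).
    + unfold Z, k. field.
    + rewrite P, Hw. ring.
Qed.

(** tau1 and a solve y'' = k^2 y with k = 2r and k = r. Then
    tau - tau2 / (4 r^2) and b - (3/2) r tau + tau1 / 4 are constant. *)
Lemma normal_form_bachelier_field r sigma xi : r <> 0 -> sigma <> 0 ->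
  (exists tau tau1 tau2 a a1 b psi,
     normal_form r sigma xi tau tau1 tau2 a a1 b psi) <->
  (exists c1 c2 c3 c4 c5 c6 psi, solution (bachelier r sigma) psi /\
     veq xi (bachelier_field r sigma c1 c2 c3 c4 c5 c6 psi)).
Proof.
  intros hr hsigma.
  assert (E0 : forall t, exp (r * t) <> 0) by (intro; apply Rgt_not_eq, exp_pos).
  split.
  - intros (tau & tau1 & tau2 & a & a1 & b & psi & H).
    destruct H as (Ht & Ht1 & Ht2 & Ha & Ha1 & Hb & Hpsi & e).
    destruct (hyperbolic_ode (2 * r) tau1 tau2) as (c5 & c4 & e1);
      [lra|assumption|intro; replace ((2 * r) ^ 2) with (4 * r ^ 2) by ring; auto|].
    destruct (hyperbolic_ode r a a1) as (c2 & c3 & ea); [assumption..|].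
    assert (et : forall t, tau t - / (2 * r) ^ 2 * tau2 t
                           = tau 0 - / (2 * r) ^ 2 * tau2 0).
    { apply (is_derive_0_const (fun t => tau t - / (2 * r) ^ 2 * tau2 t)).
      intro t. auto_derive; [ex_derive_known|]. Derive_known. now field. }
    assert (eb : forall t, b t - 3 / 2 * r * tau t + / 4 * tau1 t
                           = b 0 - 3 / 2 * r * tau 0 + / 4 * tau1 0).
    { apply (is_derive_0_const (fun t => b t - 3 / 2 * r * tau t + / 4 * tau1 t)).
      intro t. auto_derive; [ex_derive_known|]. Derive_known. now field. }
    set (c1 := tau 0 - / (2 * r) ^ 2 * tau2 0) in et.
    set (d := b 0 - 3 / 2 * r * tau 0 + / 4 * tau1 0) in eb.
    (* b contains (3/2) r tau, so the constant c1 of tau is absorbed in c6 *)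
    exists c1, c2, c3, c4, c5, (d + 3 / 2 * r * c1), psi. split; [assumption|].
    intros t s c. destruct (e t s c) as (v1 & v2 & v3). rewrite v1, v2, v3.
    cbn -[pow].
    destruct (e1 t) as [f1 f2]. destruct (ea t) as [g1 g2].
    assert (ft := et t). assert (fb := eb t).
    replace (b t) with (d + 3 / 2 * r * tau t - / 4 * tau1 t) by lra.
    replace (tau t) with (c1 + / (2 * r) ^ 2 * tau2 t) by lra.
    rewrite f1, f2, g1, g2. exp_powers.
    generalize (E0 t). generalize (exp (r * t)). intros X HX.
    repeat split; field; auto.
  - intros (c1 & c2 & c3 & c4 & c5 & c6 & psi & Hpsi & e).
    exists (fun t => c1 - exp (-2 * r * t) * (c4 - c5 * exp (4 * r * t)) / (2 * r)),
      (fun t => c4 * exp (-2 * r * t) + c5 * exp (2 * r * t)),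
      (fun t => 2 * r * (c5 * exp (2 * r * t) - c4 * exp (-2 * r * t))),
      (fun t => c2 * exp (r * t) + c3 * exp (- r * t)),
      (fun t => r * (c2 * exp (r * t) - c3 * exp (- r * t))),
      (fun t => c6 - c4 * exp (-2 * r * t) + c5 * / 2 * exp (2 * r * t)),
      psi.
    unfold normal_form.
    split; [|split; [|split; [|split; [|split; [|split; [|split; [assumption|]]]]]]].
    1-6: intro t; auto_derive; [easy|];
      exp_powers;
      generalize (E0 t); generalize (exp (r * t)); intros X HX; field; auto.
    intros t s c. destruct (e t s c) as (v1 & v2 & v3). rewrite v1, v2, v3.
    cbn -[pow].
    exp_powers.
    generalize (E0 t). generalize (exp (r * t)). intros X HX.
    repeat split; field; auto.
Qed.

Lemma symmetry_iff r sigma xi : r <> 0 -> sigma <> 0 -> smooth_field xi ->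
  (lie_point_symmetry (bachelier r sigma) xi <->
   exists c1 c2 c3 c4 c5 c6 psi, solution (bachelier r sigma) psi /\
     veq xi (bachelier_field r sigma c1 c2 c3 c4 c5 c6 psi)).
Proof.
  intros hr hsigma Hs.
  rewrite symmetry_determining, <- normal_form_bachelier_field by assumption.
  split.
  - now apply determining_normal_form.
  - intros (tau & tau1 & tau2 & a & a1 & b & psi & H).
    eapply normal_form_determining; eassumption.
Qed.

(** * Smoothness of the explicit symmetries *)

(** An algebra of functions that contains the components of the symmetries with
    psi = 0 and that is closed under partial derivatives. *)
Inductive elementary : (R -> R -> R -> R) -> Prop :=
| el_const k : elementary (fun _ _ _ => k)
| el_s : elementary (fun _ s _ => s)
| el_c : elementary (fun _ _ c => c)
| el_exp k : elementary (fun t _ _ => exp (k * t))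
| el_plus f g : elementary f -> elementary g ->
    elementary (fun t s c => f t s c + g t s c)
| el_mult f g : elementary f -> elementary g ->
    elementary (fun t s c => f t s c * g t s c).

Lemma elementary_continuous f : elementary f -> class3 0 f.
Proof.
  intros H t s c. induction H; cbn.
  - apply continuous_const.
  - apply (continuous_comp fst snd); [apply continuous_fst|apply continuous_snd].
  - apply continuous_snd.
  - apply (continuous_comp (fun p : R * R * R => fst (fst p)) (fun t => exp (k * t))).
    + apply (continuous_comp fst fst); apply continuous_fst.
    + apply (ex_derive_continuous (fun t => exp (k * t))). now auto_derive.
  - apply (continuous_plus (fun p : R * R * R => f (fst (fst p)) (snd (fst p)) (snd p))
      (fun p : R * R * R => g (fst (fst p)) (snd (fst p)) (snd p))); assumption.
  - apply (continuous_mult (fun p : R * R * R => f (fst (fst p)) (snd (fst p)) (snd p))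
      (fun p : R * R * R => g (fst (fst p)) (snd (fst p)) (snd p))); assumption.
Qed.

Lemma elementary_ex_derive f : elementary f -> forall t s c,
  ex_derive (fun x => f x s c) t /\ ex_derive (fun x => f t x c) s /\
  ex_derive (fun x => f t s x) c.
Proof.
  intros H t s c. induction H; repeat split; now auto_derive.
Qed.

Lemma elementary_d f : elementary f ->
  elementary (d1 f) /\ elementary (d2 f) /\ elementary (d3 f).
Proof.
  assert (E : forall f g, elementary f -> (forall t s c, g t s c = f t s c) ->
    elementary g).
  { intros g h Hg e. replace h with g; [assumption|].
    repeat (apply functional_extensionality; intro). auto. }
  intros H. induction H.
  - repeat split; (eapply E; [apply (el_const 0)|]; intros t s c;
      apply is_derive_unique; now auto_derive).
  - repeat split.
    1,3: eapply E; [apply (el_const 0)|]; intros t s c;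
      apply is_derive_unique; now auto_derive.
    eapply E; [apply (el_const 1)|]; intros t s c;
      apply is_derive_unique; now auto_derive.
  - repeat split.
    1,2: eapply E; [apply (el_const 0)|]; intros t s c;
      apply is_derive_unique; now auto_derive.
    eapply E; [apply (el_const 1)|]; intros t s c;
      apply is_derive_unique; now auto_derive.
  - repeat split.
    2,3: eapply E; [apply (el_const 0)|]; intros t s c;
      apply is_derive_unique; now auto_derive.
    eapply E; [apply (el_mult _ _ (el_const k) (el_exp k))|]; intros t s c;
      apply is_derive_unique; auto_derive; [easy|ring].
  - destruct IHelementary1 as (f1 & f2 & f3), IHelementary2 as (g1 & g2 & g3).
    pose proof (elementary_ex_derive f H) as ef.
    pose proof (elementary_ex_derive g H0) as eg.
    split; [|split].
    + apply (E _ _ (el_plus _ _ f1 g1)). intros t s c.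
      exact (Derive_plus (fun x => f x s c) (fun x => g x s c) t
        (proj1 (ef t s c)) (proj1 (eg t s c))).
    + apply (E _ _ (el_plus _ _ f2 g2)). intros t s c.
      exact (Derive_plus (fun x => f t x c) (fun x => g t x c) s
        (proj1 (proj2 (ef t s c))) (proj1 (proj2 (eg t s c)))).
    + apply (E _ _ (el_plus _ _ f3 g3)). intros t s c.
      exact (Derive_plus (fun x => f t s x) (fun x => g t s x) c
        (proj2 (proj2 (ef t s c))) (proj2 (proj2 (eg t s c)))).
  - destruct IHelementary1 as (f1 & f2 & f3), IHelementary2 as (g1 & g2 & g3).
    pose proof (elementary_ex_derive f H) as ef.
    pose proof (elementary_ex_derive g H0) as eg.
    split; [|split].
    + apply (E _ _ (el_plus _ _ (el_mult _ _ f1 H0) (el_mult _ _ H g1))).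
      intros t s c.
      exact (Derive_mult (fun x => f x s c) (fun x => g x s c) t
        (proj1 (ef t s c)) (proj1 (eg t s c))).
    + apply (E _ _ (el_plus _ _ (el_mult _ _ f2 H0) (el_mult _ _ H g2))).
      intros t s c.
      exact (Derive_mult (fun x => f t x c) (fun x => g t x c) s
        (proj1 (proj2 (ef t s c))) (proj1 (proj2 (eg t s c)))).
    + apply (E _ _ (el_plus _ _ (el_mult _ _ f3 H0) (el_mult _ _ H g3))).
      intros t s c.
      exact (Derive_mult (fun x => f t s x) (fun x => g t s x) c
        (proj2 (proj2 (ef t s c))) (proj2 (proj2 (eg t s c)))).
Qed.

(** The class is stable under derivatives, so its continuity and
    differentiability are inherited at every order. *)
Lemma elementary_smooth f : elementary f -> smooth3 f.
Proof.
  intros H k. revert f H. induction k as [|k IH]; intros f H.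
  - now apply elementary_continuous.
  - destruct (elementary_d f H) as (h1 & h2 & h3).
    pose proof (elementary_ex_derive f H) as ef.
    split; [exact (fun t s c => proj1 (ef t s c))|].
    split; [exact (fun t s c => proj1 (proj2 (ef t s c)))|].
    split; [exact (fun t s c => proj2 (proj2 (ef t s c)))|].
    exact (conj (IH _ h1) (conj (IH _ h2) (IH _ h3))).
Qed.

Lemma smooth2_zero : smooth2 (fun _ _ => 0).
Proof.
  intro k. induction k as [|k IH].
  - intros t s. apply continuous_const.
  - repeat split; try (intros; apply ex_derive_const).
    + replace (fun t s : R => Derive (fun _ => 0) t) with (fun _ _ : R => 0);
        [exact IH|].
      do 2 (apply functional_extensionality; intro).
      now rewrite Derive_const.
    + replace (fun t s : R => Derive (fun _ => 0) s) with (fun _ _ : R => 0);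
        [exact IH|].
      do 2 (apply functional_extensionality; intro).
      now rewrite Derive_const.
Qed.

Lemma solution_zero r sigma : solution (bachelier r sigma) (fun _ _ => 0).
Proof.
  split; [apply smooth2_zero|]. intros t s. unfold bachelier; cbn.
  rewrite !Derive_const.
  rewrite (Derive_ext _ (fun _ => 0)) by (intro; apply Derive_const).
  rewrite Derive_const. ring.
Qed.

(** * The Lie algebra of the symmetries with psi = 0 *)

Definition bachelier_field0 r sigma c1 c2 c3 c4 c5 c6 : vfield :=
  bachelier_field r sigma c1 c2 c3 c4 c5 c6 (fun _ _ => 0).

Lemma bachelier_field0_smooth r sigma c1 c2 c3 c4 c5 c6 :
  r <> 0 -> sigma <> 0 ->
  smooth_field (bachelier_field0 r sigma c1 c2 c3 c4 c5 c6).
Proof.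
  intros hr hsigma.
  replace (bachelier_field0 r sigma c1 c2 c3 c4 c5 c6) with (VField
    (fun t s c => c1 + (- c4 / (2 * r) * exp (-2 * r * t)
                        + c5 / (2 * r) * exp (2 * r * t)))
    (fun t s c => (c2 * exp (r * t) + c3 * exp (- r * t))
      + (c4 / 2 * exp (-2 * r * t) + c5 / 2 * exp (2 * r * t)) * s)
    (fun t s c => (c6 + (- c4 * exp (-2 * r * t) + c5 / 2 * exp (2 * r * t))
      + (-2 * r * c3 / sigma ^ 2 * exp (- r * t) * s
         + - r * c4 / sigma ^ 2 * exp (-2 * r * t) * s * s)) * c)).
  - split; [|split]; apply elementary_smooth; cbn -[pow];
      repeat first [apply el_const | apply el_s | apply el_c | apply el_exp
                   | apply el_plus | apply el_mult].
  - apply veq_eq. intros t s c; cbn -[pow]. exp_powers.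
    assert (HX : exp (r * t) <> 0) by apply Rgt_not_eq, exp_pos.
    repeat split; field; auto.
Qed.

(** Smoothness and symmetry are automatic for the fields with psi = 0, so
    membership is equality with one of them. *)
Lemma bachelier_algebra_iff r sigma xi : r <> 0 -> sigma <> 0 ->
  (bachelier_algebra r sigma xi <->
   exists c1 c2 c3 c4 c5 c6, xi = bachelier_field0 r sigma c1 c2 c3 c4 c5 c6).
Proof.
  intros hr hsigma. split.
  - intros (_ & _ & c1 & c2 & c3 & c4 & c5 & c6 & e).
    exists c1, c2, c3, c4, c5, c6. now apply veq_eq.
  - intros (c1 & c2 & c3 & c4 & c5 & c6 & ->).
    assert (Hs := bachelier_field0_smooth r sigma c1 c2 c3 c4 c5 c6 hr hsigma).
    split; [assumption|]. split.
    + apply symmetry_iff; [assumption..|].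
      exists c1, c2, c3, c4, c5, c6, (fun _ _ => 0).
      split; [apply solution_zero|]. repeat split.
    + exists c1, c2, c3, c4, c5, c6. repeat split.
Qed.

Ltac field_eq r :=
  apply veq_eq; intros t s c; cbn -[pow]; exp_powers;
  let X := fresh "X" in let HX := fresh "HX" in
  assert (HX : exp (r * t) <> 0) by apply Rgt_not_eq, exp_pos;
  revert HX; generalize (exp (r * t)); intros X HX;
  repeat split; field; auto.

Lemma vzero_bachelier_field0 r sigma : r <> 0 -> sigma <> 0 ->
  vzero = bachelier_field0 r sigma 0 0 0 0 0 0.
Proof. intros hr hsigma. field_eq r. Qed.

Lemma vadd_bachelier_field0 r sigma c1 c2 c3 c4 c5 c6 k1 k2 k3 k4 k5 k6 :
  r <> 0 -> sigma <> 0 ->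
  vadd (bachelier_field0 r sigma c1 c2 c3 c4 c5 c6)
       (bachelier_field0 r sigma k1 k2 k3 k4 k5 k6)
  = bachelier_field0 r sigma (c1 + k1) (c2 + k2) (c3 + k3) (c4 + k4) (c5 + k5)
      (c6 + k6).
Proof. intros hr hsigma. field_eq r. Qed.

Lemma vscale_bachelier_field0 r sigma c1 c2 c3 c4 c5 c6 k :
  r <> 0 -> sigma <> 0 ->
  vscale k (bachelier_field0 r sigma c1 c2 c3 c4 c5 c6)
  = bachelier_field0 r sigma (k * c1) (k * c2) (k * c3) (k * c4) (k * c5)
      (k * c6).
Proof. intros hr hsigma. field_eq r. Qed.

(** The nonzero brackets of the basis fields are
      [x1,x2] = r x2,   [x1,x3] = -r x3,   [x1,x4] = -2r x4,   [x1,x5] = 2r x5,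
      [x2,x3] = -(2r/sigma^2) x6,   [x2,x4] = x3,   [x3,x5] = x2,
      [x4,x5] = -(1/r) x1 - (3/2) x6. *)
Lemma bracket_bachelier_field0 r sigma c1 c2 c3 c4 c5 c6 k1 k2 k3 k4 k5 k6 :
  r <> 0 -> sigma <> 0 ->
  bracket (bachelier_field0 r sigma c1 c2 c3 c4 c5 c6)
          (bachelier_field0 r sigma k1 k2 k3 k4 k5 k6)
  = bachelier_field0 r sigma
      (- (c4 * k5 - c5 * k4) / r)
      (r * (c1 * k2 - c2 * k1) + (c3 * k5 - c5 * k3))
      (- r * (c1 * k3 - c3 * k1) + (c2 * k4 - c4 * k2))
      (- 2 * r * (c1 * k4 - c4 * k1))
      (2 * r * (c1 * k5 - c5 * k1))
      (- 2 * r / sigma ^ 2 * (c2 * k3 - c3 * k2) - 3 / 2 * (c4 * k5 - c5 * k4)).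
Proof.
  intros hr hsigma.
  assert (hs2 : sigma ^ 2 <> 0) by now apply pow_nonzero.
  apply veq_eq; intros t s c; unfold bracket, vact; cbn -[pow].
  repeat match goal with |- context [Derive ?f ?x] =>
    erewrite (is_derive_unique f x) by
      (auto_derive; [repeat split; auto; lra|reflexivity])
  end.
  exp_powers.
  assert (HX : exp (r * t) <> 0) by apply Rgt_not_eq, exp_pos.
  revert HX. generalize (exp (r * t)). intros X HX.
  repeat split; field; auto.
Qed.

Lemma bachelier_lie_algebra r sigma : r <> 0 -> sigma <> 0 ->
  lie_algebra (bachelier_algebra r sigma).
Proof.
  intros hr hsigma. unfold lie_algebra.
  setoid_rewrite (fun xi => bachelier_algebra_iff r sigma xi hr hsigma).
  repeat split.
  - do 6 eexists. now apply vzero_bachelier_field0.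
  - intros xi eta (c1 & c2 & c3 & c4 & c5 & c6 & ->)
      (k1 & k2 & k3 & k4 & k5 & k6 & ->).
    do 6 eexists. now apply vadd_bachelier_field0.
  - intros k xi (c1 & c2 & c3 & c4 & c5 & c6 & ->).
    do 6 eexists. now apply vscale_bachelier_field0.
  - intros xi eta (c1 & c2 & c3 & c4 & c5 & c6 & ->)
      (k1 & k2 & k3 & k4 & k5 & k6 & ->).
    do 6 eexists. now apply bracket_bachelier_field0.
Qed.

Lemma lincomb_bachelier_field0 r sigma c1 c2 c3 c4 c5 c6 :
  r <> 0 -> sigma <> 0 ->
  lincomb [c1; c2; c3; c4; c5; c6]
    [xi1; xi2 r; xi3 r sigma; xi4 r sigma; xi5 r; xi6]
  = bachelier_field0 r sigma c1 c2 c3 c4 c5 c6.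
Proof. intros hr hsigma. field_eq r. Qed.

(** With X = e^(rt), which takes all positive values, the t-component at S = 0
    gives the polynomial 2 r c1 X^2 - c4 + c5 X^4 and the S-component gives
    c2 X^2 + c3; three values of X make all these coefficients vanish, and
    then the C-component at the point (0, 0, 1) is c6. *)
Lemma bachelier_field0_independent r sigma c1 c2 c3 c4 c5 c6 :
  r <> 0 -> sigma <> 0 ->
  veq (bachelier_field0 r sigma c1 c2 c3 c4 c5 c6) vzero ->
  c1 = 0 /\ c2 = 0 /\ c3 = 0 /\ c4 = 0 /\ c5 = 0 /\ c6 = 0.
Proof.
  intros hr hsigma H.
  assert (Q : forall X, 0 < X ->
    2 * r * c1 * X ^ 2 - c4 + c5 * X ^ 4 = 0 /\ c2 * X ^ 2 + c3 = 0).
  { intros X HX. destruct (H (ln X / r) 0 0) as (e1 & e2 & _).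
    cbn -[pow] in e1, e2. revert e1 e2. exp_powers.
    replace (r * (ln X / r)) with (ln X) by now field.
    rewrite exp_ln by assumption. intros e1 e2. split.
    - transitivity (2 * r * X ^ 2 *
        (c1 - / X ^ 2 * (c4 - c5 * X ^ 4) / (2 * r))); [field; lra|].
      rewrite e1. ring.
    - transitivity (X * (1 / 2 * / X ^ 2 * (2 * c2 * X ^ 3 + 2 * c3 * X +
        c4 * 0 + c5 * 0 * X ^ 4))); [field; lra|].
      rewrite e2. ring. }
  destruct (Q 1 ltac:(lra)) as [p1 q1]. destruct (Q 2 ltac:(lra)) as [p2 q2].
  destruct (Q 3 ltac:(lra)) as [p3 _].
  assert (h1 : 2 * r * c1 = 0) by lra.
  assert (h2 : c1 = 0) by (apply (Rmult_eq_reg_l (2 * r)); lra).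
  destruct (H 0 0 1) as (_ & _ & e). cbn -[pow] in e.
  rewrite !Rmult_0_r, exp_0 in e.
  assert (h4 : c4 = 0) by lra. assert (h5 : c5 = 0) by lra.
  assert (h6 : c6 = 0).
  { rewrite <- e, h4, h5. now field. }
  repeat split; trivial; lra.
Qed.

Lemma bachelier_basis r sigma : r <> 0 -> sigma <> 0 ->
  is_basis (bachelier_algebra r sigma)
     [xi1; xi2 r; xi3 r sigma; xi4 r sigma; xi5 r; xi6].
Proof.
  intros hr hsigma. split; [|split].
  - intros xi Hin. apply bachelier_algebra_iff; [assumption..|].
    destruct Hin as [<-|[<-|[<-|[<-|[<-|[<-|[]]]]]]].
    + exists 1, 0, 0, 0, 0, 0. field_eq r.
    + exists 0, 1, 0, 0, 0, 0. field_eq r.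
    + exists 0, 0, 1, 0, 0, 0. field_eq r.
    + exists 0, 0, 0, 1, 0, 0. field_eq r.
    + exists 0, 0, 0, 0, 1, 0. field_eq r.
    + exists 0, 0, 0, 0, 0, 1. field_eq r.
  - intros xi H. apply bachelier_algebra_iff in H; [|assumption..].
    destruct H as (c1 & c2 & c3 & c4 & c5 & c6 & ->).
    exists [c1; c2; c3; c4; c5; c6]. split; [reflexivity|].
    rewrite lincomb_bachelier_field0 by assumption. repeat split.
  - intros a Ha H.
    destruct a as [|c1 [|c2 [|c3 [|c4 [|c5 [|c6 [|? ?]]]]]]]; try discriminate.
    rewrite (lincomb_bachelier_field0 r sigma) in H by assumption.
    apply bachelier_field0_independent in H; [|assumption..].
    destruct H as (h1 & h2 & h3 & h4 & h5 & h6).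
    intros x [<-|[<-|[<-|[<-|[<-|[<-|[]]]]]]]; assumption.
Qed.

(** * The one-parameter groups *)

Lemma reparametrization_linear k : k <> 0 -> reparametrization (fun l => k * l).
Proof.
  intro hk.
  assert (D : Derive (fun l => k * l) = fun _ => k).
  { apply functional_extensionality; intro x. apply is_derive_unique.
    auto_derive; [easy|ring]. }
  assert (D2 : forall n, Derive_n (fun l => k * l) (S (S n)) = fun _ => 0).
  { induction n as [|n IH].
    - cbn [Derive_n]. apply functional_extensionality; intro x.
      change (fun x0 : R => Derive (fun l => k * l) x0)
        with (Derive (fun l => k * l)). rewrite D. apply Derive_const.
    - change (Derive (Derive_n (fun l => k * l) (S (S n))) = fun _ => 0).
      rewrite IH. apply functional_extensionality; intro x.
      apply Derive_const. }
  split; [ring|]. split; [|split].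
  - intros [|[|[|n]]] x.
    + exact I.
    + cbn [ex_derive_n Derive_n]. now auto_derive.
    + change (ex_derive (Derive (fun l => k * l)) x).
      rewrite D. apply ex_derive_const.
    + change (ex_derive (Derive_n (fun l => k * l) (S (S n))) x).
      rewrite D2. apply ex_derive_const.
  - intro x. now rewrite D.
  - intro y. exists (y / k). now field.
Qed.

(** Reduces the claim to coordinate functions x, y, z of an arbitrary integral
    curve, with the group parameter k times the flow parameter. *)
Lemma generates_linear k xi E G : k <> 0 ->
  (forall q, open_interval_at_0 (fun l => E (k * l) q)) ->
  (forall q, G (k * 0) q = q) ->
  (forall q, integral_curve xi (fun l => E (k * l) q) (fun l => G (k * l) q)) ->
  (forall (J : R -> Prop) (x y z : R -> R), open_interval_at_0 J ->
     (forall l, J l -> is_derive x l (vt xi (x l) (y l) (z l)) /\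
                       is_derive y l (vs xi (x l) (y l) (z l)) /\
                       is_derive z l (vc xi (x l) (y l) (z l))) ->
     forall l, J l -> E (k * l) (x 0, y 0, z 0) /\
                      (x l, y l, z l) = G (k * l) (x 0, y 0, z 0)) ->
  generates xi E G.
Proof.
  intros hk H1 H2 H3 H4. exists (fun l => k * l).
  split; [now apply reparametrization_linear|].
  intro q. split; [apply H1|]. split; [apply H2|]. split; [apply H3|].
  intros J g HJ Hg g0 l Hl.
  assert (eg : forall l, g l = (pt (g l), ps (g l), pc (g l))).
  { intro m. unfold pt, ps, pc. now destruct (g m) as [[? ?] ?]. }
  rewrite (eg l). rewrite <- g0, (eg 0).
  exact (H4 J (fun l => pt (g l)) (fun l => ps (g l)) (fun l => pc (g l))
           HJ Hg l Hl).
Qed.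

Lemma open_interval_below u : 0 < u ->
  open_interval_at_0 (fun l => u + -1 * l > 0).
Proof.
  intro hu. split; [|split].
  - apply (open_ext (fun l => l < u)); [intro; lra|apply open_lt].
  - lra.
  - intros; lra.
Qed.

Lemma exp_half_ln r u : r <> 0 -> 0 < u -> exp (r * (ln u / (2 * r))) = sqrt u.
Proof.
  intros hr hu. rewrite <- Rpower_sqrt by assumption. unfold Rpower.
  f_equal. now field.
Qed.

(** Proves F l = F 0 for a quantity F conserved along integral curves, reducing
    it to the vanishing of the derivative of F. *)
Ltac conserve J HJ H F :=
  refine (conserved J F HJ _ _ _); [|eassumption];
  let l := fresh "l" in let Hl := fresh "Hl" in
  intros l Hl; destruct (H l Hl) as (Hx & Hy & Hz); cbn -[pow] in Hx, Hy, Hz;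
  auto_derive; [ex_derive_known|Derive_known].

Lemma G1_flow : generates xi1 everywhere G1.
Proof.
  apply (generates_linear 1); [lra|intro; apply open_interval_R|..].
  - intros [[t s] c]. cbn. now rewrite Rmult_0_r, Rplus_0_r.
  - intros [[t s] c] l _. cbn. split; [|split]; auto_derive; easy || ring.
  - intros J x y z HJ H l Hl. split; [exact I|]. cbn.
    assert (ex : x l - l = x 0 - 0) by (conserve J HJ H (fun l => x l - l); ring).
    assert (ey : y l = y 0) by (apply (conserved J y HJ); trivial; apply H).
    assert (ez : z l = z 0) by (apply (conserved J z HJ); trivial; apply H).
    f_equal; [f_equal|]; lra.
Qed.

Lemma G2_flow r : generates (xi2 r) everywhere (G2 r).
Proof.
  apply (generates_linear 1); [lra|intro; apply open_interval_R|..].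
  - intros [[t s] c]. cbn. now rewrite Rmult_0_r, Rmult_0_l, Rplus_0_r.
  - intros [[t s] c] l _. cbn. split; [|split]; auto_derive; easy || ring.
  - intros J x y z HJ H l Hl. split; [exact I|]. cbn.
    assert (ex : forall l, J l -> x l = x 0)
      by (apply (conserved J x HJ); trivial; apply H).
    assert (ey : y l - l * exp (r * x 0) = y 0 - 0 * exp (r * x 0)).
    { conserve J HJ H (fun l => y l - l * exp (r * x 0)). rewrite ex by trivial. ring. }
    assert (ez : z l = z 0) by (apply (conserved J z HJ); trivial; apply H).
    rewrite ex by trivial. f_equal; [f_equal|]; lra.
Qed.

(** t and S - lambda e^(-rt) are conserved, as is C e^(r S^2 / sigma^2). *)
Lemma G3_flow r sigma : sigma <> 0 ->
  generates (xi3 r sigma) everywhere (G3 r sigma).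
Proof.
  intro hsigma.
  apply (generates_linear 1); [lra|intro; apply open_interval_R|..].
  - intros [[t s] c]. cbn -[pow].
    rewrite Rmult_0_r, !Rmult_0_l, Rplus_0_r, Rdiv_0_l, Ropp_0, exp_0.
    now rewrite Rmult_1_l.
  - intros [[t s] c] l _. cbn -[pow].
    split; [auto_derive; easy|]. split; [auto_derive; [easy|ring]|].
    eapply is_derive_exp_mult; [auto_derive; [easy|reflexivity]| |].
    + auto_derive; [easy|reflexivity].
    + now field.
  - intros J x y z HJ H l Hl. split; [exact I|]. cbn -[pow].
    assert (ex : forall l, J l -> x l = x 0)
      by (apply (conserved J x HJ); trivial; apply H).
    assert (ey : y l - l * exp (- r * x 0) = y 0 - 0 * exp (- r * x 0)).
    { conserve J HJ H (fun l => y l - l * exp (- r * x 0)).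
      rewrite ex by trivial. ring. }
    assert (ez : z l * exp (r * y l ^ 2 / sigma ^ 2)
                 = z 0 * exp (r * y 0 ^ 2 / sigma ^ 2)).
    { conserve J HJ H (fun l => z l * exp (r * y l ^ 2 / sigma ^ 2)).
      now field. }
    rewrite ex by trivial. f_equal; [f_equal; lra|].
    apply (Rmult_eq_reg_r (exp (r * y l ^ 2 / sigma ^ 2)));
      [|apply Rgt_not_eq, exp_pos].
    rewrite ez.
    match goal with |- _ = exp ?A * ?c * exp ?B =>
      transitivity (c * (exp A * exp B)); [|ring] end.
    rewrite <- exp_plus. f_equal. f_equal.
    replace (y l) with (y 0 + l * exp (- r * x 0)) by lra. now field.
Qed.

Lemma G6_flow : generates xi6 everywhere G6.
Proof.
  apply (generates_linear 1); [lra|intro; apply open_interval_R|..].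
  - intros [[t s] c]. cbn. now rewrite Rmult_0_r, exp_0, Rmult_1_l.
  - intros [[t s] c] l _. cbn. split; [|split]; auto_derive; easy || ring.
  - intros J x y z HJ H l Hl. split; [exact I|]. cbn.
    assert (ex : x l = x 0) by (apply (conserved J x HJ); trivial; apply H).
    assert (ey : y l = y 0) by (apply (conserved J y HJ); trivial; apply H).
    assert (ez : z l * exp (- l) = z 0 * exp (- 0))
      by (conserve J HJ H (fun l => z l * exp (- l)); ring).
    rewrite Ropp_0, exp_0, Rmult_1_r in ez.
    rewrite ex, ey, <- ez, Rmult_1_l, exp_Ropp.
    f_equal. field. apply Rgt_not_eq, exp_pos.
Qed.

(** With u = e^(2rt) - lambda at the starting point, all quantities on the curve
    are rational in W = sqrt u and e^(rt), up to the common exponential. *)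
Lemma G4_flow r sigma : r <> 0 -> sigma <> 0 ->
  generates (xi4 r sigma) (dom4 r) (G4 r sigma).
Proof.
  intros hr hsigma. unfold dom4.
  apply (generates_linear (-1)); [lra|..].
  - intro q. apply open_interval_below, exp_pos.
  - intros [[t s] c]. cbn -[pow].
    assert (HX : 0 < exp (r * t)) by apply exp_pos.
    rewrite Rmult_0_r, Rplus_0_r, ln_exp.
    replace (sqrt (exp (2 * r * t))) with (exp (r * t))
      by (rewrite exp_pow_2, sqrt_pow2; lra).
    f_equal; [f_equal; field; lra|].
    match goal with |- exp ?A * _ * _ = _ => replace A with (- (2 * r * t)) end.
    + rewrite exp_Ropp. field. apply Rgt_not_eq, exp_pos.
    + field. split; [apply Rgt_not_eq, exp_pos|assumption].
  - intros [[t s] c] l. cbn -[pow]. intro hu.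
    set (u := exp (2 * r * t) + -1 * l) in *.
    assert (hW : 0 < sqrt u) by now apply sqrt_lt_R0.
    assert (eW : u = sqrt u ^ 2) by (rewrite pow2_sqrt; lra).
    rewrite exp_pow_m2, exp_half_ln by assumption.
    split; [|split].
    + auto_derive; [exact hu|]. fold u. rewrite <- eW. field. lra.
    + auto_derive; fold u; [repeat split; trivial; lra|].
      clearbody u. revert hW eW. generalize (sqrt u). intros W hW ->. field. lra.
    + eapply is_derive_ext; [intro; symmetry; apply Rmult_assoc|].
      eapply is_derive_exp_mult.
      * auto_derive; fold u; [|reflexivity].
        apply Rmult_integral_contrapositive. split; [|lra].
        exact (pow_nonzero sigma 2 hsigma).
      * auto_derive; [easy|reflexivity].
      * assert (HX : exp (r * t) <> 0) by apply Rgt_not_eq, exp_pos.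
        fold u. assert (el : l = exp (r * t) ^ 2 - u)
          by (unfold u; rewrite exp_pow_2; ring).
        clearbody u.
        match goal with |- context [exp ?A * u * c] => generalize (exp A) end.
        intro Y. revert hW eW. generalize (sqrt u). intros W hW eW.
        rewrite el, eW. field. lra.
  - intros J x y z HJ H l Hl.
    assert (ex : exp (2 * r * x l) + l = exp (2 * r * x 0) + 0).
    { conserve J HJ H (fun l => exp (2 * r * x l) + l).
      exp_powers. field_exp. }
    assert (ey : y l * exp (r * x l) = y 0 * exp (r * x 0)).
    { conserve J HJ H (fun l => y l * exp (r * x l)).
      exp_powers. field_exp. }
    assert (ez : z l * exp (-2 * r * x l + r * y l ^ 2 / sigma ^ 2)
                 = z 0 * exp (-2 * r * x 0 + r * y 0 ^ 2 / sigma ^ 2)).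
    { conserve J HJ H
        (fun l => z l * exp (-2 * r * x l + r * y l ^ 2 / sigma ^ 2)).
      exp_powers. field_exp. }
    assert (hp : 0 < exp (r * x l)) by apply exp_pos.
    assert (hp0 : 0 < exp (r * x 0)) by apply exp_pos.
    cbn -[pow]. unfold pt; cbn -[pow].
    replace (exp (2 * r * x 0) + -1 * l) with (exp (2 * r * x l)) by lra.
    split; [apply exp_pos|].
    rewrite ln_exp. rewrite (exp_pow_2 r (x l)), sqrt_pow2 by lra.
    f_equal; [f_equal; [now field|]|].
    + apply (Rmult_eq_reg_r (exp (r * x l))); [|lra]. rewrite ey. field. lra.
    + apply (Rmult_eq_reg_r (exp (-2 * r * x l + r * y l ^ 2 / sigma ^ 2)));
        [|apply Rgt_not_eq, exp_pos].
      rewrite ez. rewrite <- exp_pow_2.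
      match goal with |- _ = exp ?A * exp ?B * ?c * exp ?C =>
        transitivity (c * (exp A * exp B * exp C)); [|ring] end.
      rewrite <- !exp_plus. f_equal. f_equal.
      replace (y l) with (y 0 * exp (r * x 0) / exp (r * x l))
        by (rewrite <- ey; field; lra).
      rewrite exp_pow_2.
      replace l with (exp (r * x 0) ^ 2 - exp (r * x l) ^ 2) at 2
        by (rewrite <- !exp_pow_2; lra).
      field. split; [lra|assumption].
Qed.

(** Mirrors the case of xi4 under t -> -t, and C now scales like S. *)
Lemma G5_flow r : r <> 0 -> generates (xi5 r) (dom5 r) (G5 r).
Proof.
  intros hr. unfold dom5.
  apply (generates_linear (-1)); [lra|..].
  - intro q. apply open_interval_below, exp_pos.
  - intros [[t s] c]. cbn -[pow].
    assert (HX : 0 < exp (- r * t)) by apply exp_pos.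
    rewrite Rmult_0_r, Rplus_0_r, ln_exp.
    replace (sqrt (exp (-2 * r * t))) with (exp (- r * t)).
    + f_equal; [f_equal|]; field; lra.
    + symmetry. apply sqrt_lem_1; try (left; apply exp_pos).
      rewrite <- exp_plus. f_equal. ring.
  - intros [[t s] c] l. cbn -[pow]. intro hu.
    set (u := exp (-2 * r * t) + -1 * l) in *.
    assert (hW : 0 < sqrt u) by now apply sqrt_lt_R0.
    assert (eW : u = sqrt u ^ 2) by (rewrite pow2_sqrt; lra).
    assert (ee : exp (2 * r * - (ln u / (2 * r))) = / sqrt u ^ 2).
    { rewrite <- (exp_half_ln r), <- exp_pow_m2 by assumption. f_equal. ring. }
    rewrite ee. clear ee.
    split; [|split].
    + auto_derive; [exact hu|]. fold u. rewrite <- eW. field. lra.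
    + auto_derive; fold u; [repeat split; trivial; lra|].
      clearbody u. revert hW eW. generalize (sqrt u). intros W hW ->. field. lra.
    + auto_derive; fold u; [repeat split; trivial; lra|].
      clearbody u. revert hW eW. generalize (sqrt u). intros W hW ->. field. lra.
  - intros J x y z HJ H l Hl.
    assert (ex : exp (-2 * r * x l) + l = exp (-2 * r * x 0) + 0).
    { conserve J HJ H (fun l => exp (-2 * r * x l) + l).
      exp_powers. field_exp. }
    assert (ey : y l * exp (- r * x l) = y 0 * exp (- r * x 0)).
    { conserve J HJ H (fun l => y l * exp (- r * x l)).
      exp_powers. field_exp. }
    assert (ez : z l * exp (- r * x l) = z 0 * exp (- r * x 0)).
    { conserve J HJ H (fun l => z l * exp (- r * x l)).
      exp_powers. field_exp. }
    assert (hp : 0 < exp (- r * x l)) by apply exp_pos.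
    cbn -[pow]. unfold pt; cbn -[pow].
    replace (exp (-2 * r * x 0) + -1 * l) with (exp (-2 * r * x l)) by lra.
    split; [apply exp_pos|].
    rewrite ln_exp.
    replace (sqrt (exp (-2 * r * x l))) with (exp (- r * x l)).
    + f_equal; [f_equal; [field; lra|]|].
      * apply (Rmult_eq_reg_r (exp (- r * x l))); [|lra]. rewrite ey. field. lra.
      * apply (Rmult_eq_reg_r (exp (- r * x l))); [|lra]. rewrite ez. field. lra.
    + symmetry. apply sqrt_lem_1; try (left; apply exp_pos).
      rewrite <- exp_plus. f_equal. ring.
Qed.

(** * The theorem *)

Theorem mainTheorem1 (r sigma : R) (hr : r <> 0) (hsigma : sigma <> 0) :
  (forall xi : vfield, smooth_field xi ->
     (lie_point_symmetry (bachelier r sigma) xi <->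
      exists (c1 c2 c3 c4 c5 c6 : R) (psi : R -> R -> R),
        solution (bachelier r sigma) psi /\
        veq xi (bachelier_field r sigma c1 c2 c3 c4 c5 c6 psi))) /\
  (lie_algebra (bachelier_algebra r sigma) /\
   is_basis (bachelier_algebra r sigma)
     [xi1; xi2 r; xi3 r sigma; xi4 r sigma; xi5 r; xi6]) /\
  (generates xi1 everywhere G1 /\
   generates (xi2 r) everywhere (G2 r) /\
   generates (xi3 r sigma) everywhere (G3 r sigma) /\
   generates (xi4 r sigma) (dom4 r) (G4 r sigma) /\
   generates (xi5 r) (dom5 r) (G5 r) /\
   generates xi6 everywhere G6).
Proof.
  split; [|split; [split|split; [|split; [|split; [|split; [|split]]]]]].
  - intros xi Hs. now apply symmetry_iff.
  - now apply bachelier_lie_algebra.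
  - now apply bachelier_basis.
  - apply G1_flow.
  - apply G2_flow.
  - now apply G3_flow.
  - now apply G4_flow.
  - now apply G5_flow.
  - apply G6_flow.
Qed.
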